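(* Let $p$ be a prime with $p\equiv1\pmod4$, and write $p=a^2+b^2$ with $a,b\in\mathbb Z$ and $a\equiv1\pmod4$. Then $$\sum_{k=0}^{\frac{p-1}2}\frac{\binom{2k}k^2}{8^k}\equiv\sum_{k=0}^{\frac{p-1}2}\frac{\binom{2k}k^2}{(-16)^k}\equiv P_{\frac{p-1}2}(3)\equiv(-1)^{\frac{p-1}4}\Big(2a-\frac p{2a}\Big)\pmod{p^2}.$$
   Context: Congruences are between rational numbers whose denominators are prime to $p$. $P_n(x)$ is the $n$-th Legendre polynomial, defined by $\frac1{\sqrt{1-2xt+t^2}}=\sum_{n\ge0}P_n(x)t^n$, equivalently $P_n(x)=\frac1{2^n}\sum_{k=0}^{[n/2]}\frac{(-1)^k(2n-2k)!}{k!(n-k)!(n-2k)!}x^{n-2k}$. *)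

(* Defs.v *)
From mathcomp Require Import all_boot all_order all_algebra.
Set Implicit Arguments. Unset Strict Implicit. Unset Printing Implicit Defensive.
Import Order.TTheory GRing.Theory Num.Theory.
Local Open Scope ring_scope.

Definition p_integral (p : nat) (q : rat) : bool := coprime p `|denq q|%N.

Definition rat_congr (p : nat) (m : nat) (x y : rat) : Prop :=
  p_integral p ((x - y) / m%:R).

Definition legendreP (n : nat) (x : rat) : rat :=
  (2%:R ^+ n)^-1 *
  \sum_(0 <= k < n./2.+1)
     ((-1) ^+ k * ((2 * n - 2 * k)`!)%:R
       / ((k`!)%:R * ((n - k)`!)%:R * ((n - 2 * k)`!)%:R) * x ^+ (n - 2 * k)).

(* Main.v *)
Require Import Defs.
From mathcomp Require Import all_boot all_order all_algebra all_solvable all_field.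
From mathcomp Require Import ring zify.
Set Implicit Arguments. Unset Strict Implicit. Unset Printing Implicit Defensive.
Import Order.TTheory GRing.Theory Num.Theory.
Local Open Scope ring_scope.

(* Write p = 4m + 1 and n = 2m.  The three quantities S8, S16 and P_n(3) all reduce to
   D = sum_k C(n,k) C(n+k,k) modulo p^2: use P_n(-3) = P_n(3) and
   (-16)^k C(n,k) C(n+k,k) = C(2k,k)^2 mod p^2.  Let H_j be the harmonic numbers.

   Since 2 / k! = 1 / prod_{i<=k} (i - p) + 1 / prod_{i<=k} (i + p) mod p^2, 2D is a sum of two terminating hypergeometric
   series at -1 of Kummer type, both of which have closed forms; this gives
   2D = (-1)^m C(2m,m) (2 + p (H_m - H_{2m})).

   On the other side, let T be the Teichmuller character of F_p with values in Z/p^2,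
   and J = sum_x T(x)^{3m} T(1-x)^{2m}.  Expanding (1 - T(x))^B by the binomial formula
   and summing over x evaluates J in terms of C(2m,m) and C(6m,m), and gives D = - J.
   Finally J times its conjugate is p, while J plus its conjugate is the integer
   sum_y (y (1 - y^2) / p), which is identified with -(-1)^m 2a by Jacobsthal's sums of
   two squares and a count of orbits of y |-> -y, 1/y.  So D is the unit root of
   X^2 - (-1)^m 2a X + p. *)

(** * Legendre polynomials *)

Lemma coef_XaddC_exp (R : comNzRingType) (c : R) (N n : nat) :
  (('X + c%:P) ^+ N)`_n = 'C(N, n)%:R * c ^+ (N - n).
Proof.
rewrite addrC exprDn coef_sum.
under eq_bigr do rewrite -mulr_natl -polyC_exp mulrA -polyC_natr -polyCM coefCM coefXn.
have [nN|Nn] := leqP n N; last first.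
  rewrite bin_small // mul0r big1 // => i _.
  by rewrite (_ : (n == i) = false) ?mulr0 //; have := ltn_ord i; lia.
rewrite (bigD1 (Ordinal (nN : (n < N.+1)%N))) //= eqxx mulr1 big1 ?addr0 // => i.
by rewrite -val_eqE /= eq_sym => /negbTE ->; rewrite mulr0.
Qed.

Lemma fact_neq0 (n : nat) : (n`!)%:R != 0 :> rat.
Proof. by rewrite pnatr_eq0 -lt0n fact_gt0. Qed.

Lemma legendrePE (n : nat) (x : rat) :
  legendreP n x = \sum_(k < n.+1) ('C(n, k) * 'C(n + k, k))%:R * ((x - 1) / 2) ^+ k.
Proof.
(* Both sides are 2^-n times the coefficient of X^n in ((X + x)^2 - 1)^n. *)
pose Y : {poly rat} := 'X + x%:P.
have n2 : n./2 = (n - uphalf n)%N by lia.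
have lhs : ((Y ^+ 2 - 1) ^+ n)`_n = 2 ^+ n * legendreP n x.
  rewrite /legendreP mulrA divff ?mul1r ?expf_neq0 //.
  rewrite exprDn coef_sum.
  rewrite -(big_mkord xpredT (fun i : nat => ((Y ^+ 2) ^+ (n - i) * (-1) ^+ i *+ 'C(n, i))`_n)).
  (* For i > n/2 the power of [Y] has degree 2(n - i) < n and contributes nothing, which explains
     the summation range of [legendreP]. *)
  rewrite (big_cat_nat (n := n./2.+1)) //=; last by lia.
  rewrite [X in _ + X]big_nat_cond [X in _ + X]big1 ?addr0; last first.
    move=> i; rewrite andbT => /andP[i1 i2].
    rewrite -exprM coefMn -(rmorphN1 polyC) -polyC_exp mulrC coefCM coef_XaddC_exp.
    by rewrite bin_small ?mul0r ?mulr0 ?mul0rn //; lia.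
  rewrite big_nat_cond [RHS]big_nat_cond; apply: eq_bigr => i; rewrite andbT => /andP[_ i2].
  rewrite -exprM coefMn -(rmorphN1 polyC) -polyC_exp mulrC coefCM coef_XaddC_exp.
  rewrite -[LHS]mulr_natl mulnBr.
  have e1 : (n - i)`!%:R != 0 :> rat by exact: fact_neq0.
  have E1 : 'C(n, i)%:R = n`!%:R / (i`!%:R * (n - i)`!%:R) :> rat.
    by rewrite -(@bin_fact n i) ?natrM ?mulfK ?mulf_neq0 ?fact_neq0 //; lia.
  have E2 : 'C(2 * n - 2 * i, n)%:R = (2 * n - 2 * i)`!%:R / (n`!%:R * (n - 2 * i)`!%:R) :> rat.
    rewrite -(@bin_fact (2 * n - 2 * i) n); last by lia.
    rewrite (_ : 2 * n - 2 * i - n = n - 2 * i)%N; last by lia.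
    by rewrite !natrM mulfK ?mulf_neq0 ?fact_neq0.
  rewrite E1 E2 (_ : 2 * n - 2 * i - n = n - 2 * i)%N; last by lia.
  by field; rewrite !fact_neq0.
have rhs : ((Y ^+ 2 - 1) ^+ n)`_n =
    2 ^+ n * \sum_(k < n.+1) ('C(n, k) * 'C(n + k, k))%:R * ((x - 1) / 2) ^+ k.
  (* With Z = X + x - 1 one has Y = Z + 1, so the k-th term of the expansion is a multiple of
     Z^(n+k). *)
  have -> : Y ^+ 2 - 1 = 2%:P * ('X + (x - 1)%:P) + ('X + (x - 1)%:P) ^+ 2.
    by rewrite /Y polyCB polyC1 (_ : 2%:P = 2) ?polyC_natr //; ring.
  rewrite exprDn coef_sum mulr_sumr; apply: eq_bigr => k _.
  rewrite exprMn -mulrA -exprM -exprD coefMn -polyC_exp coefCM coef_XaddC_exp.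
  have kn : (k <= n)%N by rewrite -ltnS.
  rewrite (_ : n - k + 2 * k = n + k)%N; last by lia.
  rewrite (_ : n + k - n = k)%N; last by lia.
  rewrite -(@bin_sub (n + k) k) ?leq_addl // addnK.
  have -> : 2 ^+ n = 2 ^+ (n - k) * 2 ^+ k :> rat by rewrite -exprD subnK.
  rewrite expr_div_n -[LHS]mulr_natl natrM.
  by field; rewrite expf_neq0.
by apply: (mulfI (x := 2 ^+ n)); rewrite ?expf_neq0 // -lhs rhs.
Qed.

Lemma legendrePN (n : nat) (x : rat) : legendreP n (- x) = (-1) ^+ n * legendreP n x.
Proof.
rewrite /legendreP [RHS]mulrCA; congr (_ * _); rewrite mulr_sumr.
rewrite big_nat_cond [RHS]big_nat_cond; apply: eq_bigr => k; rewrite andbT => /andP[_ kn].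
rewrite (exprNn x) [LHS]mulrCA; congr (_ * _).
rewrite -signr_odd -[RHS]signr_odd; congr (_ ^+ nat_of_bool _).
by lia.
Qed.

(** * Binomial sums in closed form *)

(** A partial fraction decomposition. Pascal's rule writes the sum for n + 1 as the difference of
    the sums for n at x and at x + d. *)
Lemma sum_bin_alt_inv (F : fieldType) (d : F) (n : nat) (x : F) :
  (forall i : nat, (i <= n)%N -> x + i%:R * d != 0) ->
  \sum_(i < n.+1) (-1) ^+ i * 'C(n, i)%:R / (x + i%:R * d) =
  n`!%:R * d ^+ n / \prod_(i < n.+1) (x + i%:R * d).
Proof.
elim: n x => [|n IHn] x x0.
  by rewrite !big_ord1 /= expr0 bin0 fact0 expr0.
have shift (i : nat) : x + (bump 0 i)%:R * d = x + d + i%:R * d.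
  by rewrite /bump /= -natr1; ring.
have y0 (i : nat) : (i <= n)%N -> x + d + i%:R * d != 0.
  by move=> le_in; rewrite -shift; apply: x0.
have -> : \sum_(i < n.+2) (-1) ^+ i * 'C(n.+1, i)%:R / (x + i%:R * d) =
    \sum_(i < n.+1) (-1) ^+ i * 'C(n, i)%:R / (x + i%:R * d) -
    \sum_(i < n.+1) (-1) ^+ i * 'C(n, i)%:R / (x + d + i%:R * d).
  have -> : \sum_(i < n.+1) (-1) ^+ i * 'C(n, i)%:R / (x + i%:R * d) =
      \sum_(i < n.+2) (-1) ^+ i * 'C(n, i)%:R / (x + i%:R * d).
    by rewrite [RHS]big_ord_recr /= bin_small // mulr0 mul0r addr0.
  rewrite big_ord_recl [in RHS]big_ord_recl /= !bin0 -addrA; congr (_ + _).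
  rewrite -sumrB; apply: eq_bigr => i _.
  by rewrite shift /bump /= add1n binS natrD exprS; ring.
rewrite IHn => [|i le_in]; last by apply: x0; lia.
rewrite IHn // [X in X - _ = _](_ : _ =
    n`!%:R * d ^+ n * (x + d + n%:R * d) / \prod_(i < n.+2) (x + i%:R * d)); last first.
  by rewrite [in RHS]big_ord_recr /= -shift /bump -mulf_div divff ?mulr1 ?x0.
rewrite [X in _ - X = _](_ : _ =
    n`!%:R * d ^+ n * x / \prod_(i < n.+2) (x + i%:R * d)); last first.
  rewrite [in RHS]big_ord_recl /= mul0r addr0; under [in RHS]eq_bigr do rewrite shift.
  have x00 : x != 0 by have := x0 0%N isT; rewrite mul0r addr0.
  by rewrite [x * _]mulrC -mulf_div divff ?mulr1.
by rewrite -mulrBl factS natrM exprS -natr1; congr (_ / _); ring.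
Qed.

(** The coefficient of t^N in (1 + t)^-(a+1) (1 - t)^-(b+1). *)
Definition bin_conv (a b N : nat) : int :=
  \sum_(k < N.+1) (-1) ^+ k * ('C(a + k, k) * 'C(b + (N - k), N - k))%:R.

(** Multiplying the generating series by 1 + t lowers a by one; [bin_convSr] lowers b through 1 -
    t. *)
Lemma bin_convSl (a b N : nat) :
  bin_conv a.+1 b N.+1 + bin_conv a.+1 b N = bin_conv a b N.+1.
Proof.
rewrite /bin_conv big_ord_recl [RHS]big_ord_recl /= !bin0 -addrA; congr (_ + _).
rewrite -big_split /=; apply: eq_bigr => k _.
by rewrite /bump /= add1n subSS !addnS !addSn binS exprS !natrM natrD; ring.
Qed.

Lemma bin_convSr (a b N : nat) :
  bin_conv a b.+1 N.+1 - bin_conv a b.+1 N = bin_conv a b N.+1.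
Proof.
rewrite /bin_conv big_ord_recr [RHS]big_ord_recr /= subnn !bin0 addrAC; congr (_ + _).
rewrite -sumrB; apply: eq_bigr => k _.
have -> : (N.+1 - k = (N - k).+1)%N by rewrite subSn // -ltnS.
by rewrite !addnS !addSn binS !natrM natrD; ring.
Qed.

(* The coefficients of (1 + t)^-(a+1) (1 - t)^-(a+1) = (1 - t^2)^-(a+1). *)
Lemma bin_conv_diag (a m : nat) : bin_conv a a m.*2 = 'C(a + m, m)%:R.
Proof.
(* Both rules combined: multiplying the series by 1 - t^2 lowers the two parameters together. *)
have step (b M : nat) : bin_conv b.+1 b.+1 M.+2 = bin_conv b.+1 b.+1 M + bin_conv b b M.+2.
  by rewrite -(bin_convSl b b) -(bin_convSr b.+1 b M.+1) -(bin_convSr b.+1 b M); ring.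
elim: a m => [|a IHa] m.
  rewrite /bin_conv; under eq_bigr => k _ do rewrite !add0n !binn muln1 mulr1.
  rewrite add0n binn; elim: m => [|m IHm]; first by rewrite big_ord1.
  by rewrite doubleS 2!big_ord_recr /= IHm !exprS; ring.
elim: m => [|m IHm]; first by rewrite /bin_conv big_ord1 /= !bin0 mulr1.
rewrite doubleS step IHm -doubleS IHa.
by rewrite !addnS !addSn [in RHS]binS natrD addrC.
Qed.

Lemma prod_rising_fact (e l : nat) :
  \prod_(i < l) (e.+1%:R + i%:R * 1) = (e + l)`!%:R / e`!%:R :> rat.
Proof.
elim: l => [|l IHl]; first by rewrite big_ord0 addn0 divff // pnatr_eq0 -lt0n fact_gt0.
by rewrite big_ord_recr /= IHl addnS factS natrM mulr1 -natrD addSn; ring.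
Qed.

(** * A beta-type integral evaluated in two ways *)

Section BetaSum.
Variable n : nat.

(* The linear form X^i |-> \int_0^1 t^(n+i) dt on polynomials of degree at most 2n. *)
Let moment (q : {poly rat}) : rat := \sum_(i < n.*2.+1) q`_i / (n.+1 + i)%:R.

Let moment_sum (I : finType) (F : I -> {poly rat}) :
  moment (\sum_i F i) = \sum_i moment (F i).
Proof.
by rewrite exchange_big; apply: eq_bigr => i _; rewrite coef_sum mulr_suml.
Qed.

Let momentXn (c : rat) (e : nat) : (e <= n.*2)%N ->
  moment (c *: 'X^e) = c / (n.+1 + e)%:R.
Proof.
move=> le_e; rewrite /moment (bigD1 (Ordinal (le_e : (e < n.*2.+1)%N))) //=.
rewrite coefZ coefXn eqxx mulr1 big1 ?addr0 // => i.
by rewrite -val_eqE /= coefZ coefXn => /negbTE ->; rewrite mulr0 mul0r.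
Qed.

(** The integral of t^n (1 - t^2)^n over [0, 1] is computed twice: expanding only (1 + t)^n leaves
    beta integrals, expanding (1 - t^2)^n leaves denominators in steps of 2. [sum_bin_alt_inv]
    closes both, with d = 1 and d = 2. *)
Lemma sum_bin_fact_ratio :
  \sum_(k < n.+1) ('C(n, k) * (n + k)`! * n`!)%:R / ((n.*2.+1 + k)`!)%:R =
  2 ^+ n * n`!%:R / (\prod_(i < n.+1) (n.+1 + i.*2))%:R :> rat.
Proof.
have lhs : moment ((1 + 'X) ^+ n * (1 - 'X) ^+ n) =
    \sum_(k < n.+1) ('C(n, k) * (n + k)`! * n`!)%:R / ((n.*2.+1 + k)`!)%:R.
  rewrite [(1 + _) ^+ n]exprDn mulr_suml moment_sum; apply: eq_bigr => k _.
  rewrite exprDn mulr_sumr moment_sum.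
  transitivity ('C(n, k)%:R *
      \sum_(i < n.+1) (-1) ^+ i * 'C(n, i)%:R / ((n + k).+1%:R + i%:R * 1) : rat).
    rewrite mulr_sumr; apply: eq_bigr => i _.
    rewrite !expr1n !mul1r (exprNn 'X).
    rewrite [X in moment X](_ : _ = ((-1) ^+ i * 'C(n, i)%:R * 'C(n, k)%:R) *: 'X^(k + i)).
      rewrite momentXn; last by have := ltn_ord k; have := ltn_ord i; lia.
      by rewrite mulr1 -natrD addnA addSn; ring.
    rewrite -mul_polyC !polyCM !polyC_natr polyC_exp polyCN polyC1 exprD.
    by ring.
  rewrite sum_bin_alt_inv => [|i _]; last by rewrite mulr1 -natrD pnatr_eq0.
  have -> : \prod_(i < n.+1) ((n + k).+1%:R + i%:R * 1) =
      (n.*2.+1 + k)`!%:R / (n + k)`!%:R :> rat.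
    rewrite (_ : n.*2.+1 + k = (n + k) + n.+1)%N; last by lia.
    exact: prod_rising_fact.
  have f0 (j : nat) : j`!%:R != 0 :> rat by rewrite pnatr_eq0 -lt0n fact_gt0.
  rewrite expr1n; move: (f0 (n.*2.+1 + k)%N) (f0 (n + k)%N).
  move: (n.*2.+1 + k)`! => a a0; rewrite !natrM => b0.
  by field; rewrite a0 b0.
have rhs : moment ((1 + 'X) ^+ n * (1 - 'X) ^+ n) =
    2 ^+ n * n`!%:R / (\prod_(i < n.+1) (n.+1 + i.*2))%:R.
  rewrite -exprMn (_ : (1 + 'X) * (1 - 'X) = 1 - 'X ^+ 2 :> {poly rat}); last by ring.
  rewrite exprDn moment_sum [2 ^+ n * _]mulrC natr_prod.
  under [in RHS]eq_bigr => i _ do rewrite natrD -muln2 natrM.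
  rewrite -sum_bin_alt_inv => [|i _]; last by rewrite -natrM -natrD pnatr_eq0.
  apply: eq_bigr => i _; rewrite expr1n mul1r (exprNn ('X ^+ 2)) -exprM.
  rewrite [X in moment X](_ : _ = ((-1) ^+ i * 'C(n, i)%:R) *: 'X^(2 * i)).
    rewrite momentXn; last by have := ltn_ord i; lia.
    by rewrite natrD [(2 * i)%N]mulnC natrM.
  rewrite -mul_polyC !polyCM !polyC_natr polyC_exp polyCN polyC1.
  by ring.
by rewrite -lhs rhs.
Qed.

End BetaSum.

(** The factors are the odd numbers from 2m + 1 to 6m + 1, which are symmetric about 4m + 1. *)
Lemma prod_odd_window (m : nat) :
  (\prod_(i < m.*2.+1) (m.*2.+1 + i.*2) =
   (4 * m).+1 * \prod_(j < m) (((4 * m).+1 - j.+1.*2) * ((4 * m).+1 + j.+1.*2)))%N.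
Proof.
have -> : (m.*2.+1 = m + m.+1)%N by lia.
rewrite big_split_ord /= big_ord_recl /= mulnCA; congr (_ * _)%N; first by lia.
rewrite big_split /=; congr (_ * _)%N.
  rewrite (reindex_inj rev_ord_inj) /=; apply: eq_bigr => i _; have := ltn_ord i; lia.
by apply: eq_bigr => i _; rewrite /bump /=; lia.
Qed.

(** This is [sum_bin_fact_ratio] with denominators cleared, ready to be mapped into a ring where p
    is nilpotent. The factor p of p! must cancel beforehand, against the middle factor isolated by
    [prod_odd_window]. *)
Lemma sum_fact_prod_shift (m : nat) (n := m.*2) (p := (4 * m).+1) :
  ((\sum_(k < n.+1) ('C(n, k) * 'C(n + k, k) * k`! * \prod_(k <= i < n) (p + i.+1))) *
    ((m.*2)`! * \prod_(j < m) ((p - j.+1.*2) * (p + j.+1.*2))) =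
  4 ^ m * (4 * m)`! * \prod_(0 <= i < n) (p + i.+1))%N.
Proof.
have p_eq : p = (4 * m).+1 by [].
have n_eq : n = m.*2 by [].
clearbody n p.
have pn : p = n.*2.+1 by rewrite p_eq n_eq; lia.
have f0 (k : nat) : k`!%:R != 0 :> rat by rewrite pnatr_eq0 -lt0n fact_gt0.
have prodE (k : nat) : (\prod_(0 <= i < k) (p + i.+1) * p`! = (p + k)`!)%N.
  elim: k => [|k IHk]; first by rewrite big_nil mul1n addn0.
  by rewrite big_nat_recr //= addnS factS -addnS -IHk; lia.
have termE (k : nat) : (k <= n)%N ->
    ('C(n, k) * 'C(n + k, k) * k`! * \prod_(k <= i < n) (p + i.+1))%:R =
    (p`!%:R * (\prod_(0 <= i < n) (p + i.+1))%:R / (n`!%:R ^+ 2)) *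
    (('C(n, k) * (n + k)`! * n`!)%:R / ((p + k)`!)%:R) :> rat.
  move=> kn; have e1 : 'C(n + k, k)%:R = (n + k)`!%:R / (k`!%:R * n`!%:R) :> rat.
    by rewrite -(@bin_fact (n + k) k) ?leq_addl // addnK !natrM mulfK ?mulf_neq0.
  rewrite (big_cat_nat (m := 0) (n := k) (p := n)) //= -prodE !natrM e1.
  have q0 : (\prod_(0 <= i < k) (p + i.+1))%:R != 0 :> rat.
    by rewrite pnatr_eq0 -lt0n prodn_gt0 // => i; rewrite addnS.
  by field; rewrite !f0 q0.
have cast (x y : nat) : x%:R = y%:R :> rat -> x = y by move/eqP; rewrite eqr_nat => /eqP.
apply: cast; rewrite natrM natr_sum (eq_bigr _ (fun (k : 'I_n.+1) _ => termE k (ltn_ord k))).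
rewrite -mulr_sumr pn sum_bin_fact_ratio n_eq prod_odd_window -n_eq -pn -p_eq.
set Q := (\prod_(j < m) _)%N; have Q0 : Q%:R != 0 :> rat.
  rewrite pnatr_eq0 -lt0n; apply/prodn_gt0 => i; rewrite muln_gt0.
  by have := ltn_ord i; rewrite p_eq; lia.
rewrite (_ : 4 ^ m = 2 ^ n)%N; last by rewrite n_eq -mul2n expnM.
have -> : (p`! = p * (4 * m)`!)%N by rewrite p_eq factS.
rewrite !natrM natrX; field.
by rewrite Q0 f0 pnatr_eq0 p_eq.
Qed.

(** * Binomial coefficients modulo p^2 *)

Section PrimeSquareZero.
Variables (R : comUnitRingType) (p : nat).
Hypothesis p_prime : prime p.
Hypothesis p_sqr0 : p%:R ^+ 2 = 0 :> R.
Hypothesis natr_unit : forall k : nat, coprime p k -> k%:R \is a @GRing.unit R.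

Let P : R := p%:R.

Let p2 : P ^+ 2 = 0. Proof. exact: p_sqr0. Qed.

Lemma natr_unit_lt (k : nat) : (0 < k < p)%N -> k%:R \is a @GRing.unit R.
Proof.
move=> /andP[k0 kp]; apply: natr_unit; rewrite prime_coprime //.
by apply/negP => /(dvdn_leq k0); rewrite leqNgt kp.
Qed.

Lemma fact_unit (k : nat) : (k < p)%N -> k`!%:R \is a @GRing.unit R.
Proof.
elim: k => [|k IHk] kp; first by rewrite fact0 unitr1.
by rewrite factS natrM unitrM natr_unit_lt //= IHk // ltnW.
Qed.

Definition harmonic (k : nat) : R := \sum_(0 <= i < k) i.+1%:R^-1.

(** The product is k! times the product of the 1 + c p / i, and p^2 = 0 leaves only the term linear
    in p. *)
Lemma prod_shift (c : R) (k : nat) : (k < p)%N ->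
  \prod_(0 <= i < k) (i.+1%:R + c * P) = k`!%:R * (1 + c * P * harmonic k).
Proof.
elim: k => [|k IHk] kp.
  by rewrite /harmonic !big_nil mulr0 addr0 mulr1 fact0.
rewrite big_nat_recr //= IHk; last exact: ltnW.
rewrite /harmonic big_nat_recr //= -/(harmonic k) factS natrM.
have /mulrV : k.+1%:R \is a @GRing.unit R by apply: natr_unit_lt.
set u := k.+1%:R; set v := u^-1; set H := harmonic k; set f := k`!%:R => uv; clearbody v f H u.
transitivity (f * (u + c * P * H * u + c * P + c ^+ 2 * H * P ^+ 2)); first by ring.
by rewrite p2; ring: uv.
Qed.

Lemma one_addP_unit (c : R) : 1 + c * P \is a GRing.unit.
Proof.
by apply/unitrPr; exists (1 - c * P); ring: p2.
Qed.

Lemma prod_shift_unit (c : R) (k : nat) : (k < p)%N ->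
  \prod_(0 <= i < k) (i.+1%:R + c * P) \is a GRing.unit.
Proof.
by move=> kp; rewrite prod_shift // unitrM fact_unit //= mulrAC one_addP_unit.
Qed.

(** The quotient of the two factorials is the product of the p - i for i <= k; up to the sign (-1)^k
    this is [prod_shift] with c = -1. *)
Lemma fact_pred_split (k : nat) : (k < p)%N ->
  (p.-1)`!%:R = (p.-1 - k)`!%:R * ((-1) ^+ k * k`!%:R * (1 - P * harmonic k)).
Proof.
move=> kp; transitivity ((p.-1 - k)`!%:R * \prod_(0 <= i < k) (P - i.+1%:R)).
  elim: k kp => [|k IHk] kp; first by rewrite big_nil mulr1 subn0.
  rewrite big_nat_recr //= IHk; last exact: ltnW.
  have -> : (p.-1 - k = (p.-1 - k.+1).+1)%N by lia.
  have e : (p.-1 - k.+1).+1%:R = P - k.+1%:R.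
    by rewrite /P -natrB; [congr (_%:R) | ]; lia.
  by rewrite factS natrM e; ring.
congr (_ * _).
have -> : 1 - P * harmonic k = 1 + (-1) * P * harmonic k by ring.
rewrite -mulrA -prod_shift //.
elim: k {kp} => [|k IHk]; first by rewrite !big_nil mulr1.
by rewrite !big_nat_recr //= IHk exprS; ring.
Qed.

Variable m : nat.
Hypothesis p_eq : p = (4 * m).+1.
Let n := m.*2.

Let m_gt0 : (0 < m)%N. Proof. by move: p_prime; rewrite p_eq; case: m. Qed.

Let P4 : P = 4 * m%:R + 1.
Proof. by rewrite /P p_eq -natr1 natrM. Qed.

(** Consecutive terms are compared. Over (k+1)^2, the left ratio has numerator -16 (n - k)(n + k +
    1) = 4 ((2k+1)^2 - (2n+1)^2), the right one 4 (2k+1)^2, and 2n + 1 = p has square zero. *)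
Lemma bin_mul_central_sqr (k : nat) : (k <= n)%N ->
  (-16) ^+ k * ('C(n, k) * 'C(n + k, k))%:R = 'C(2 * k, k)%:R ^+ 2 :> R.
Proof.
elim: k => [|k IHk] kn; first by rewrite !bin0 expr0 mulr1 expr1n.
have k_unit : k.+1%:R ^+ 2 \is a @GRing.unit R.
  by rewrite unitrX // natr_unit_lt // p_eq; rewrite /n in kn; lia.
apply: (mulIr k_unit).
have e1 : (k.+1 * 'C(n, k.+1) = (n - k) * 'C(n, k))%N by exact: mul_bin_left.
have e2 : (k.+1 * 'C(n + k.+1, k.+1) = (n + k.+1) * 'C(n + k, k))%N.
  by rewrite addnS mul_bin_diag.
have e3 : (k.+1 * 'C(2 * k.+1, k.+1) = 2 * (2 * k).+1 * 'C(2 * k, k))%N.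
  apply/eqP; rewrite -(eqn_pmul2l (m := k.+1)) //; apply/eqP.
  have d1 : ((2 * k).+2 * 'C((2 * k).+1, k) = k.+1 * 'C((2 * k).+2, k.+1))%N.
    exact: mul_bin_diag.
  have d2 : ((2 * k).+1 * 'C(2 * k, k) = k.+1 * 'C((2 * k).+1, k))%N.
    rewrite -[in RHS]bin_sub; last by lia.
    by rewrite (_ : (2 * k).+1 - k = k.+1)%N ?mul_bin_diag //; lia.
  rewrite (_ : 2 * k.+1 = (2 * k).+2)%N; last by lia.
  rewrite -d1 mulnCA -d2; lia.
have f1 : k.+1%:R * 'C(n, k.+1)%:R = (n - k)%:R * 'C(n, k)%:R :> R by rewrite -!natrM e1.
have f2 : k.+1%:R * 'C(n + k.+1, k.+1)%:R = (n + k.+1)%:R * 'C(n + k, k)%:R :> R.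
  by rewrite -!natrM e2.
have f3 : k.+1%:R * 'C(2 * k.+1, k.+1)%:R = 2 * (2 * k).+1%:R * 'C(2 * k, k)%:R :> R.
  by rewrite -!natrM e3.
have := IHk (ltnW kn).
rewrite !natrM => IH.
transitivity ((-16) ^+ k.+1 * (k.+1%:R * 'C(n, k.+1)%:R) * (k.+1%:R * 'C(n + k.+1, k.+1)%:R) : R).
  by ring.
rewrite f1 f2 exprS.
transitivity (-16 * (n - k)%:R * (n + k.+1)%:R * ((-16) ^+ k * ('C(n, k)%:R * 'C(n + k, k)%:R)) : R).
  by ring.
rewrite IH [RHS]mulrC -exprMn f3 2!exprMn; congr (_ * _).
rewrite natrB; last exact: ltnW.
have P2n : P = 2 * n%:R + 1 by rewrite P4 /n -muln2 natrM; ring.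
transitivity (4 * ((2 * k%:R + 1) ^+ 2 - (2 * n%:R + 1) ^+ 2) : R); first by rewrite natrD; ring.
by rewrite -P2n p2 subr0; ring.
Qed.

Let u (k : nat) : R := ('C(n, k) * 'C(n + k, k))%:R.
Let D : R := \sum_(k < n.+1) u k.
Let rising (c : R) (k : nat) : R := \prod_(0 <= i < k) (i.+1%:R + c * P).
(** This is 2F1(-n, n+1; 1 + c p; -1). As p = 2n + 1, Kummer's condition holds for both signs: 1 - p
    = 1 + (-n) - (n+1) and 1 + p = 1 + (n+1) - (-n). *)
Let S (c : R) : R := \sum_(k < n.+1) u k * k`!%:R / rising c k.
Let H := harmonic.
Let cb : R := 'C(n, m)%:R.

Let n_lt : (n < p)%N. Proof. by rewrite p_eq /n; lia. Qed.

(** The two denominators are k! (1 - p H_k) and k! (1 + p H_k); in the sum of their inverses the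
    first-order terms cancel. *)
Let S_add : S (-1) + S 1 = 2 * D.
Proof.
rewrite /S -big_split /D mulr_sumr /=; apply: eq_bigr => k _.
have kp : (k < p)%N by apply: leq_trans n_lt; rewrite ltnS -ltnS.
rewrite -!mulrA -mulrDr [RHS]mulrC; congr (_ * _).
have r1 : rising (-1) k = k`!%:R * (1 - P * H k) by rewrite /rising prod_shift // /H; ring.
have r2 : rising 1 k = k`!%:R * (1 + P * H k) by rewrite /rising prod_shift // /H; ring.
have fu := fact_unit kp.
have iv (c : R) : (1 + c * P)^-1 = 1 - c * P.
  apply: (mulrI (one_addP_unit c)); rewrite mulrV ?one_addP_unit //.
  by ring: p2.
rewrite r1 r2 (_ : 1 - P * H k = 1 + (- H k) * P); last by ring.
rewrite (_ : 1 + P * H k = 1 + H k * P); last by ring.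
rewrite !invrM ?one_addP_unit // !iv !(mulrCA k`!%:R) mulrV //.
by ring.
Qed.

Let factE (k : nat) : (k <= n)%N ->
  rising (-1) k * (n.*2 - k)`!%:R = (-1) ^+ k * n.*2`!%:R.
Proof.
have pn : (p.-1 = n.*2)%N by rewrite p_eq /n; lia.
move=> kn; have kp : (k < p)%N by apply: leq_ltn_trans n_lt.
rewrite -pn (fact_pred_split kp) /rising prod_shift //.
have e : (-1) ^+ k * (-1) ^+ k = 1 :> R by rewrite -exprMn mulrNN mulr1 expr1n.
ring: e.
Qed.

(** After multiplication by C(2n, n), the k-th term becomes the k-th term of [bin_conv n n n]; n =
    2m is even, so [bin_conv_diag] applies. *)
Let Sm_bin : S (-1) * 'C(n.*2, n)%:R = 'C(n + m, m)%:R.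
Proof.
have := bin_conv_diag n m; rewrite /bin_conv -/n => /(congr1 (intr : int -> R)).
rewrite rmorph_sum rmorph_nat /= => <-.
rewrite /S mulr_suml; apply: eq_bigr => k _.
have kn : (k <= n)%N by rewrite -ltnS.
have kp : (k < p)%N by apply: leq_ltn_trans n_lt.
have ru : rising (-1) k \is a GRing.unit by apply: prod_shift_unit.
have fu : (n.*2 - k)`!%:R \is a @GRing.unit R.
  by apply: fact_unit; rewrite p_eq /n; lia.
rewrite rmorphM rmorph_nat rmorphXn rmorphN1.
apply: (mulIr fu); apply: (mulIr ru).
rewrite -[RHS]mulrA [_`!%:R * _]mulrC factE //.
have e : (-1) ^+ k * (-1) ^+ k = 1 :> R by rewrite -exprMn mulrNN mulr1 expr1n.
have E : ('C(n, k) * 'C(n + k, k) * k`! * 'C(n.*2, n) * (n.*2 - k)`! =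
   'C(n + k, k) * 'C(n + (n - k), n - k) * n.*2`!)%N.
  have b1 : ('C(n, k) * (k`! * (n - k)`!) = n`!)%N by exact: bin_fact.
  have b2 : ('C(n.*2, n) * (n`! * n`!) = n.*2`!)%N.
    have nn : (n.*2 - n = n)%N by lia.
    by have := @bin_fact n.*2 n; rewrite nn; apply; lia.
  have b3 : ('C(n + (n - k), n - k) * ((n - k)`! * n`!) = (n.*2 - k)`!)%N.
    rewrite (_ : n.*2 - k = n + (n - k))%N; last by lia.
    by rewrite -(@bin_fact (n + (n - k)) (n - k)) ?leq_addl // addnK.
  apply/eqP; rewrite -(eqn_pmul2r (m := n`! * (n - k)`!)) ?muln_gt0 ?fact_gt0 //.
  by rewrite -b3 -b2 -{3}b1; apply/eqP; ring.
transitivity (u k * k`!%:R * 'C(n.*2, n)%:R * (n.*2 - k)`!%:R * ((rising (-1) k)^-1 * rising (-1) k)).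
  by move: (rising _ _) (u k) => r v; ring.
rewrite (mulVr ru) mulr1.
rewrite /u -!natrM E !natrM; ring: e.
Qed.

Let four_unit : 4 \is a @GRing.unit R.
Proof. by apply: natr_unit; have := coprimeSn (4 * m); rewrite p_eq coprimeMr => /andP[]. Qed.

Let two_unit : 2 \is a @GRing.unit R.
Proof. by have := four_unit; rewrite (natrM _ 2 2) unitrM => /andP[]. Qed.

Let sqr_sign (k : nat) : (-1) ^+ k * (-1) ^+ k = 1 :> R.
Proof. by rewrite -exprMn mulrNN mulr1 expr1n. Qed.

Let m_lt : (m < p)%N. Proof. by rewrite p_eq; lia. Qed.

Let fm_unit : m`!%:R \is a @GRing.unit R. Proof. exact: fact_unit. Qed.
Let fn_unit : n`!%:R \is a @GRing.unit R. Proof. exact: fact_unit. Qed.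

Let fact_n : n`!%:R = cb * m`!%:R ^+ 2.
Proof.
have nm : (n - m = m)%N by rewrite /n; lia.
have := @bin_fact n m; rewrite nm => <-; last by rewrite /n; lia.
by rewrite !natrM.
Qed.

Let fact_4m : (4 * m)`!%:R = n`!%:R * n`!%:R * (1 - P * H n).
Proof.
have e := fact_pred_split n_lt; rewrite p_eq /= in e; rewrite e.
have -> : (4 * m - n = n)%N by rewrite /n; lia.
by rewrite -signr_odd /n odd_double mul1r mulrA.
Qed.

Let fact_4m' : (4 * m)`!%:R = (n + m)`!%:R * ((-1) ^+ m * m`!%:R * (1 - P * H m)).
Proof.
have e := fact_pred_split m_lt; rewrite p_eq /= in e; rewrite e.
by have -> : (4 * m - m = n + m)%N by rewrite /n; lia.
Qed.

Let prod_neg4_sqr (l : nat) :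
  \prod_(j < l) (-4 * j.+1%:R ^+ 2) = (-4) ^+ l * l`!%:R ^+ 2 :> R.
Proof.
elim: l => [|l IHl]; first by rewrite big_ord0 fact0 expr1n mulr1.
by rewrite big_ord_recr /= IHl factS natrM (exprS _ l); ring.
Qed.

(** The image of [sum_fact_prod_shift] in R. Each pair (p - 2j)(p + 2j) becomes -4 j^2, so the
    powers of 4 cancel up to the sign (-1)^m, and (4m)! is split at n. *)
Let Sp_bin : S 1 = (-1) ^+ m * cb * (1 - P * H n).
Proof.
have ru (k : nat) : (k <= n)%N -> rising 1 k \is a GRing.unit.
  by move=> kn; apply: prod_shift_unit; apply: leq_ltn_trans n_lt.
have castS : rising 1 n * S 1 =
    (\sum_(k < n.+1) ('C(n, k) * 'C(n + k, k) * k`! * \prod_(k <= i < n) (p + i.+1)))%:R.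
  rewrite natr_sum mulr_sumr; apply: eq_bigr => k _.
  have kn : (k <= n)%N by rewrite -ltnS.
  have -> : rising 1 n = rising 1 k * (\prod_(k <= i < n) (p + i.+1))%:R.
    rewrite /rising (big_cat_nat (m := 0) (n := k) (p := n)) //=; congr (_ * _).
    by rewrite natr_prod; apply: eq_bigr => i _; rewrite natrD mul1r addrC.
  have := mulrV (ru k kn); move: (rising 1 k) (rising 1 k)^-1 => r r' rr'.
  by rewrite /u !natrM; ring: rr'.
have castP : (\prod_(0 <= i < n) (p + i.+1))%:R = rising 1 n.
  by rewrite natr_prod; apply: eq_bigr => i _; rewrite natrD mul1r addrC.
have castQ : (\prod_(j < m) ((p - j.+1.*2) * (p + j.+1.*2)))%:R = (-4) ^+ m * m`!%:R ^+ 2 :> R.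
  rewrite -prod_neg4_sqr natr_prod; apply: eq_bigr => j _.
  rewrite natrM natrB; last by have := ltn_ord j; rewrite p_eq; lia.
  by rewrite natrD -muln2 natrM -/P; ring: p2.
have := sum_fact_prod_shift m; rewrite -/n -p_eq => /(congr1 (fun x : nat => x%:R : R)).
rewrite natrM natrM [in RHS]natrM natrM castP castQ -castS natrX => E.
have E' : S 1 * (n`!%:R * ((-4) ^+ m * m`!%:R ^+ 2)) = 4 ^+ m * (4 * m)`!%:R.
  apply: (mulrI (ru n (leqnn n))); rewrite [RHS]mulrC -E; exact: mulrA.
have f_unit : 4 ^+ m * (n`!%:R * m`!%:R ^+ 2) \is a @GRing.unit R.
  by rewrite unitrM (unitrX _ four_unit) unitrM fn_unit (unitrX _ fm_unit).
apply: (mulIr f_unit); have e := sqr_sign m.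
transitivity ((-1) ^+ m * (S 1 * (n`!%:R * ((-4) ^+ m * m`!%:R ^+ 2)))).
  by rewrite [(-4) ^+ m]exprNn; ring: e.
by rewrite E' fact_4m fact_n; ring.
Qed.

(** Splitting (4m)! at n and at m evaluates both binomials of [Sm_bin]; the common factor 1 - p H_n
    is a unit and cancels. *)
Let Sm_eq : S (-1) = (-1) ^+ m * cb * (1 + P * H m).
Proof.
have Cn : 'C(n.*2, n)%:R = 1 - P * H n.
  have nn : (n.*2 - n = n)%N by lia.
  have := @bin_fact n.*2 n; rewrite nn => /(_ ltac:(lia))/(congr1 (fun x : nat => x%:R : R)).
  rewrite !natrM (_ : n.*2 = 4 * m)%N ?fact_4m; last by rewrite /n; lia.
  rewrite mulrC => E; apply: (mulrI (_ : n`!%:R * n`!%:R \is a GRing.unit)) => //.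
  by rewrite unitrM fn_unit.
have C3 : 'C(n + m, m)%:R * ((-1) ^+ m * (1 - P * H m)) = cb * (1 - P * H n).
  have f_unit : n`!%:R * m`!%:R ^+ 2 \is a @GRing.unit R by rewrite unitrM fn_unit (unitrX _ fm_unit).
  apply: (mulIr f_unit).
  have := @bin_fact (n + m) m (leq_addl _ _); rewrite addnK => /(congr1 (fun x : nat => x%:R : R)).
  rewrite !natrM => E.
  transitivity ('C(n + m, m)%:R * (m`!%:R * n`!%:R) * ((-1) ^+ m * m`!%:R * (1 - P * H m))).
    by ring.
  by rewrite E -fact_4m' fact_4m {1}fact_n; ring.
have := Sm_bin; rewrite Cn => E.
have unit_n : 1 - P * H n \is a GRing.unit.
  by rewrite -mulrN mulrC one_addP_unit.
apply: (mulIr unit_n); rewrite E.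
have e := sqr_sign m.
transitivity ('C(n + m, m)%:R * ((-1) ^+ m * (1 - P * H m)) * ((-1) ^+ m * (1 + P * H m))).
  ring: e p2.
by rewrite C3; ring.
Qed.

Lemma double_sum_bin_mul :
  2 * (\sum_(k < n.+1) ('C(n, k) * 'C(n + k, k))%:R) =
  (-1) ^+ m * 'C(n, m)%:R * (2 + P * (harmonic m - harmonic n)).
Proof. by rewrite -/D -S_add Sp_bin Sm_eq /cb /H; ring. Qed.

(** Invertibility of D is what singles it out among the roots of its quadratic equation: C(n, m)
    divides n!, and the remaining factor is 2 up to a nilpotent. *)
Lemma sum_bin_mul_unit :
  \sum_(k < n.+1) ('C(n, k) * 'C(n + k, k))%:R \is a @GRing.unit R.
Proof.
have : 2 * (\sum_(k < n.+1) ('C(n, k) * 'C(n + k, k))%:R) \is a @GRing.unit R.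
  rewrite double_sum_bin_mul !unitrM unitrX ?unitrN1 //=; apply/andP; split.
    by have := fn_unit; rewrite fact_n unitrM => /andP[].
  have -> : 2 + P * (harmonic m - harmonic n) =
      2 * (1 + (2^-1 * (harmonic m - harmonic n)) * P).
    move: (mulrV two_unit); move: (2^-1) => t v.
    transitivity (2 + 2 * t * (P * (harmonic m - harmonic n))); first by rewrite v mul1r.
    by ring.
  by rewrite unitrM two_unit one_addP_unit.
by rewrite unitrM => /andP[].
Qed.

(** Since 6m = p + n - 1 and 5m = p + m - 1, the factorials in C(6m, m) are products of the p + i,
    to which [prod_shift] applies. The last factors are 4 (p + n) = 6p - 2 and 4 (p + m) = 5p -
    1. *)
Lemma bin_6m :
  'C(6 * m, m)%:R * (1 + P * harmonic m) * (6 * P - 2) =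
  'C(n, m)%:R * (1 + P * harmonic n) * (5 * P - 1).
Proof.
have prodE (k : nat) : (\prod_(0 <= i < k) (p + i.+1) * p`! = (p + k)`!)%N.
  elim: k => [|k IHk]; first by rewrite big_nil mul1n addn0.
  by rewrite big_nat_recr //= addnS factS -addnS -IHk; lia.
have risingE (k : nat) : (\prod_(0 <= i < k) (p + i.+1))%:R = rising 1 k.
  by rewrite natr_prod; apply: eq_bigr => i _; rewrite natrD mul1r addrC.
have E : ('C(6 * m, m) * m`! * (\prod_(0 <= i < m) (p + i.+1)) * (p + n) =
          \prod_(0 <= i < n) (p + i.+1) * (p + m))%N.
  apply/eqP; rewrite -(eqn_pmul2r (fact_gt0 p)); apply/eqP.
  have b : ('C(6 * m, m) * (m`! * (5 * m)`!) = (6 * m)`!)%N.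
    have mm : (6 * m - m = 5 * m)%N by lia.
    by have := @bin_fact (6 * m) m; rewrite mm; apply; lia.
  have e5 : ((p + m)`! = (p + m) * (5 * m)`!)%N.
    have -> : (p + m = (5 * m).+1)%N by rewrite p_eq; lia.
    exact: factS.
  have e6 : ((p + n)`! = (p + n) * (6 * m)`!)%N.
    have -> : (p + n = (6 * m).+1)%N by rewrite p_eq /n; lia.
    exact: factS.
  transitivity ('C(6 * m, m) * m`! * (\prod_(0 <= i < m) (p + i.+1) * p`!) * (p + n))%N.
    by ring.
  rewrite prodE e5 mulnAC [RHS]mulnAC prodE e6 -b; ring.
have := congr1 (fun x : nat => x%:R : R) E.
rewrite !(natrM _ _ (p + _)) !natrM !risingE /rising !prod_shift // -/n fact_n => F.
have f_unit : m`!%:R ^+ 2 \is a @GRing.unit R by rewrite (unitrX _ fm_unit).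
have Pn : P = 2 * n%:R + 1 by rewrite P4 /n -muln2 natrM; ring.
have e62 : 6 * P - 2 = 4 * (P + n%:R) by rewrite Pn; ring.
have e51 : 5 * P - 1 = 4 * (P + m%:R) by rewrite P4; ring.
apply: (mulIr f_unit).
transitivity (4 * ('C(6 * m, m)%:R * m`!%:R * (m`!%:R * (1 + 1 * P * harmonic m)) * (p + n)%:R)).
  by rewrite natrD -/P e62; ring.
by rewrite F natrD -/P e51; ring.
Qed.

(** The right side is minus the value of [jacobi_sum 3] in [jacobi_sum3E]; eliminating C(6m, m) by
    [bin_6m] reduces the claim to [double_sum_bin_mul]. *)
Lemma sum_bin_mulE :
  \sum_(k < n.+1) ('C(n, k) * 'C(n + k, k))%:R =
  - ((P - 1) * (-1) ^+ m * ((1 - n%:R) * 'C(n, m)%:R + 2 * n%:R * 'C(6 * m, m)%:R)).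
Proof.
apply: (mulrI two_unit); rewrite double_sum_bin_mul.
set c6 := 'C(6 * m, m)%:R; set c := 'C(n, m)%:R.
have c6E : 2 * c6 = c * (1 + P * (harmonic n - harmonic m) - 2 * P).
  (* The last factor is twice the inverse of (1 + p H_m)(6p - 2) modulo p^2. *)
  transitivity (c6 * (1 + P * harmonic m) * (6 * P - 2) *
                (- (1 + 3 * P) * (1 - P * harmonic m))).
    by ring: p2.
  by rewrite bin_6m -/c; ring: p2.
have n2 : 2 * n%:R = P - 1 by rewrite P4 /n -muln2 natrM; ring.
transitivity (- ((P - 1) * (-1) ^+ m * ((2 - 2 * n%:R) * c + 2 * n%:R * (2 * c6)))).
  by rewrite c6E n2; ring: p2.
by ring.
Qed.
End PrimeSquareZero.

(** * Jacobi sums modulo p^2 *)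

(** It finds the terms that survive the character sum over T(x)^(3m + k), for k up to 6m. *)
Lemma dvdn_4m_cases (m k : nat) : (0 < m)%N -> (4 * m %| 3 * m + k)%N ->
  [|| k == m, k == 5 * m | 9 * m <= k]%N.
Proof. by move=> m0 /dvdnP[[|[|[|j]]] e]; nia. Qed.

(** * Fermat's theorem and primitive roots in ['F_p] *)

Section PrimeField.
Variables p m : nat.
Hypothesis p_prime : prime p.
Hypothesis p_eq : p = (4 * m).+1.

Let m_gt0 : (0 < m)%N. Proof. by move: p_prime; rewrite p_eq; case: m. Qed.

Lemma Fp_expp (x : 'F_p) : x ^+ p = x.
Proof. by have := expf_card x; rewrite card_Fp. Qed.

Lemma Fp_fermat (x : 'F_p) : x != 0 -> x ^+ (4 * m) = 1.
Proof.
by move=> x0; apply: (mulfI x0); rewrite -exprS mulr1 -p_eq Fp_expp.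
Qed.

Lemma Fp_prim_root : exists g : 'F_p, (4 * m).-primitive_root g.
Proof.
pose rs := [seq x <- enum 'F_p | x != 0].
have m4 : (0 < 4 * m)%N by rewrite muln_gt0.
have /hasP[g _ g_prim] : has (4 * m).-primitive_root rs.
  apply: has_prim_root => //; last 2 first.
  - by rewrite filter_uniq ?enum_uniq.
  - rewrite size_filter -(leq_add2l (count (pred1 0) (enum 'F_p))).
    rewrite count_predC -cardE card_Fp // p_eq count_uniq_mem ?enum_uniq //.
    by rewrite mem_enum add1n.
  by apply/allP => x; rewrite mem_filter unity_rootE => /andP[/Fp_fermat-> _].
by exists g.
Qed.

Variable g : 'F_p.
Hypothesis g_prim : (4 * m).-primitive_root g.

Lemma prim_neq0 : g != 0.
Proof.
apply/eqP => g0; have := prim_expr_order g_prim.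
by rewrite g0 expr0n muln_eq0 -[m]prednK //= => /eqP; rewrite eq_sym oner_eq0.
Qed.

Lemma prim_half : g ^+ m.*2 = -1.
Proof.
have : (g ^+ m.*2) ^+ 2 = 1.
  by rewrite -exprM muln2 (_ : m.*2.*2 = 4 * m)%N ?prim_expr_order //; lia.
move/eqP; rewrite sqrf_eq1 => /orP[|/eqP //].
rewrite -(prim_order_dvd g_prim) => /(dvdn_leq _); lia.
Qed.

End PrimeField.

(** * The Teichmuller character and quartic Jacobi sums *)

Section Teichmuller.
Variables (R : comUnitRingType) (p : nat).
Hypothesis p_prime : prime p.
Hypothesis p_sqr0 : p%:R ^+ 2 = 0 :> R.
Hypothesis natr_unit : forall k : nat, coprime p k -> k%:R \is a @GRing.unit R.

Let P : R := p%:R.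

Let p2 : P ^+ 2 = 0. Proof. exact: p_sqr0. Qed.

Lemma exprD_mulP (v w : R) (k : nat) : (v + P * w) ^+ k.+1 = v ^+ k.+1 + k.+1%:R * P * w * v ^+ k.
Proof.
elim: k => [|k IHk]; first by rewrite !expr1 expr0; ring.
by rewrite exprS IHk (exprS v k.+1) (exprS v k) -[k.+2%:R]natr1; ring: p2.
Qed.

Lemma exprp_mulP (v w : R) : (v + P * w) ^+ p = v ^+ p.
Proof.
have := exprD_mulP v w p.-1; rewrite prednK ?prime_gt0 // => ->.
by rewrite -/P -expr2 p2 !mul0r addr0.
Qed.

Lemma intr_Fp_eq0 (z : int) : z%:~R = 0 :> 'F_p -> exists w : R, z%:~R = P * w.
Proof.
move/eqP; rewrite -(dvdz_pcharf (pchar_Fp p_prime)) => /dvdzP[w ->].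
by exists w%:~R; rewrite rmorphM /= mulrC.
Qed.

(* The Teichmuller character: modulo p^2 the p-th power of a lift of x to the integers
   does not depend on the lift. *)
Definition teich (x : 'F_p) : R := (nat_of_ord x)%:R ^+ p.

Lemma teichE (z : int) : teich z%:~R = z%:~R ^+ p.
Proof.
rewrite /teich; set x : 'F_p := z%:~R.
have : (z - (nat_of_ord x)%:Z)%:~R = 0 :> 'F_p.
  by rewrite rmorphB /= -/x -[X in X - _]natr_Zp subrr.
case/intr_Fp_eq0 => w; rewrite rmorphB /= => /(canRL (subrK _)) ->.
by rewrite addrC exprp_mulP.
Qed.

Lemma intr_Fp (x : 'F_p) : (nat_of_ord x)%:~R = x.
Proof. by rewrite -[RHS]natr_Zp. Qed.

Local Notation T := teich.

Lemma teich1 : T 1 = 1. Proof. by rewrite (teichE 1) expr1n. Qed.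

Lemma teich0 : T 0 = 0.
Proof. by rewrite (teichE 0) expr0n -[p]prednK ?prime_gt0. Qed.

Lemma teichM (x y : 'F_p) : T (x * y) = T x * T y.
Proof.
by rewrite -{1}(intr_Fp x) -{1}(intr_Fp y) -intrM teichE intrM exprMn.
Qed.

Lemma teichX (x : 'F_p) (k : nat) : T (x ^+ k) = T x ^+ k.
Proof.
by elim: k => [|k IHk]; rewrite ?teich1 // !exprS teichM IHk.
Qed.

Lemma teich_unit (x : 'F_p) : x != 0 -> T x \is a GRing.unit.
Proof.
move=> x0; apply/unitrPr; exists (T x^-1).
by rewrite -teichM divff // teich1.
Qed.

Lemma intr_unit (z : int) : z%:~R != 0 :> 'F_p -> z%:~R \is a @GRing.unit R.
Proof.
move/teich_unit; rewrite teichE unitrX_pos ?prime_gt0 //.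
Qed.

(** The element is the image of an integer which reduces to x^p - 1 = x - 1 in ['F_p]. *)
Lemma teich_sub1_unit (x : 'F_p) : x != 1 -> T x - 1 \is a GRing.unit.
Proof.
move=> x1; have -> : T x - 1 = ((nat_of_ord x)%:Z ^+ p - 1)%:~R.
  by rewrite rmorphB rmorphXn.
apply: intr_unit; rewrite rmorphB rmorphXn /= -pmulrn natr_Zp.
by rewrite (Fp_expp p_prime) subr_eq0.
Qed.

(** By Fermat, 1 - X^p is also an integer lift of 1 - x when X lifts x; choosing it makes 1 - T(x)
    itself appear. *)
Lemma teich_onem (x : 'F_p) : T (1 - x) = (1 - T x) ^+ p.
Proof.
have <- : (1 - (nat_of_ord x)%:Z ^+ p)%:~R = 1 - x.
  rewrite rmorphB rmorphXn /= -pmulrn natr_Zp.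
  by rewrite (Fp_expp p_prime).
by rewrite teichE rmorphB rmorphXn.
Qed.

Variable m : nat.
Hypothesis p_eq : p = (4 * m).+1.
Let n := m.*2.

Let m_gt0 : (0 < m)%N. Proof. by move: p_prime; rewrite p_eq; case: m. Qed.

Let P4 : P = 4 * m%:R + 1.
Proof. by rewrite /P p_eq -natr1 natrM. Qed.

Variable g : 'F_p.
Hypothesis g_prim : (4 * m).-primitive_root g.

Let Fp_fermat := Fp_fermat p_prime p_eq.
Let prim_neq0 := prim_neq0 p_prime p_eq g_prim.
Let prim_half := prim_half p_prime p_eq g_prim.

(** Orthogonality: replacing x by g x multiplies the sum by T(g^k), and T(g^k) - 1 is a unit unless
    4m divides k. Positivity of k makes the term at x = 0 vanish. *)
Lemma sum_teichX (k : nat) : (0 < k)%N ->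
  \sum_x T x ^+ k = if (4 * m %| k)%N then (4 * m)%:R else 0.
Proof.
move=> k0; case: ifPn => [/dvdnP[j kj]|nk].
  rewrite (bigD1 0) //= teich0 expr0n eqn0Ngt k0 add0r.
  rewrite (eq_bigr (fun=> 1)) => [|x x0].
    rewrite sumr_const cardC1 card_Fp // p_eq //.
  by rewrite -teichX kj mulnC exprM Fp_fermat // expr1n teich1.
have u : T (g ^+ k) - 1 \is a GRing.unit.
  by apply: teich_sub1_unit; rewrite -(prim_order_dvd g_prim).
apply: (mulrI u); rewrite mulr0 mulrBl mul1r mulr_sumr.
rewrite [X in _ - X](reindex_inj (mulfI prim_neq0)) -sumrB big1 // => x _.
by rewrite teichM exprMn teichX subrr.
Qed.

(** The quadratic character, with values in R. *)
Definition teich_half (x : 'F_p) : R := T x ^+ m.*2.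
Local Notation phi := teich_half.

Let phiM (x y : 'F_p) : phi (x * y) = phi x * phi y.
Proof. by rewrite /teich_half teichM exprMn. Qed.

Let n_gt0 : (0 < n)%N. Proof. by rewrite double_gt0. Qed.

Let phi0 : phi 0 = 0.
Proof. by rewrite /teich_half teich0 expr0n eqn0Ngt n_gt0. Qed.

Let phi1 : phi 1 = 1. Proof. by rewrite /teich_half teich1 expr1n. Qed.

Let phi_sqr (x : 'F_p) : x != 0 -> phi x * phi x = 1.
Proof.
move=> x0; rewrite /teich_half -exprD addnn (_ : n.*2 = 4 * m)%N; last by rewrite /n; lia.
by rewrite -teichX Fp_fermat // teich1.
Qed.

Let sum_phi : \sum_x phi x = 0.
Proof.
rewrite sum_teichX // ifN //; apply/negP => /(dvdn_leq n_gt0); rewrite /n; lia.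
Qed.

(* Multiplicativity turns J(chi^-1, phi) J(chi, phi) into a sum over z = x / y of
   chi^-1(z) times the sum over y of phi(1 - y z) phi(1 - y); Moebius substitution
   evaluates the latter. *)
Let sum_phi_linear (z : 'F_p) : z != 0 ->
  \sum_(y | y != 0) phi (1 - y * z) * phi (1 - y) = - phi z - 1 + (z == 1)%:R * P.
Proof.
move=> z0; apply: (addrI 1).
have -> : 1 + \sum_(y | y != 0) phi (1 - y * z) * phi (1 - y) =
    \sum_y phi (1 - y * z) * phi (1 - y).
  by rewrite [RHS](bigD1 0) //= mul0r subr0 phi1 mulr1.
case: (eqVneq z 1) => [->|z1].
  rewrite (bigD1 1) //= subrr mulr1 subrr phi0 mulr0 add0r.
  rewrite (eq_bigr (fun=> 1)) => [|y y1].
    have Pp : P = p.-1%:R + 1 by rewrite natr1 prednK ?prime_gt0.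
    by rewrite sumr_const cardC1 card_Fp // phi1 Pp; ring.
  by rewrite mulr1 phi_sqr // subr_eq0 eq_sym.
(* The Moebius map only misses z; the convention that 0 is its own inverse gives h(1) = z and makes
   h a bijection. Moreover (1 - y z)(1 - y) = h(y) (1 - y)^2. *)
pose h (y : 'F_p) := z + (1 - z) / (1 - y).
have h_inj : injective h.
  have z1' : 1 - z != 0 by rewrite subr_eq0 eq_sym.
  by move=> y y' /addrI/(mulfI z1')/invr_inj/addrI/oppr_inj.
have := sum_phi; rewrite (reindex_inj h_inj) => hs.
transitivity (\sum_y phi (h y) - phi z); last by rewrite hs mul0r; ring.
rewrite (bigD1 1) //= subrr phi0 mulr0 add0r [in RHS](bigD1 1) //=.
rewrite /h subrr invr0 mulr0 addr0 addrAC subrr add0r.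
apply: eq_bigr => y y1.
have y1' : 1 - y != 0 by rewrite subr_eq0 eq_sym.
rewrite -phiM (_ : (1 - y * z) * (1 - y) = h y * ((1 - y) * (1 - y))).
  by rewrite phiM [phi ((1 - y) * _)]phiM phi_sqr // mulr1.
by rewrite /h; field.
Qed.

(** With the quartic character chi = T^m this is J(chi^i, phi); i = 3 gives chi^-1. *)
Definition jacobi_sum (i : nat) : R := \sum_x T x ^+ (i * m) * phi (1 - x).

Lemma jacobi_sum_norm : jacobi_sum 3 * jacobi_sum 1 = P.
Proof.
transitivity (\sum_y \sum_x T x ^+ (3 * m) * T y ^+ m * (phi (1 - x) * phi (1 - y))).
  rewrite mulrC /jacobi_sum mulr_suml; apply: eq_bigr => y _.
  by rewrite mulr_sumr; apply: eq_bigr => x _; rewrite mul1n; ring.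
transitivity (\sum_(y | y != 0) \sum_z T z ^+ (3 * m) * (phi (1 - y * z) * phi (1 - y))).
  rewrite (bigD1 0) //= big1 ?add0r => [|x _]; last first.
    by rewrite teich0 expr0n eqn0Ngt m_gt0 mulr0 mul0r.
  apply: eq_bigr => y y0; rewrite (reindex_inj (mulfI y0)); apply: eq_bigr => z _.
  rewrite teichM exprMn.
  have e : T y ^+ (3 * m) * T y ^+ m = 1.
    rewrite -exprD (_ : 3 * m + m = 4 * m)%N; last by rewrite -mulSnr.
    by rewrite -teichX Fp_fermat // teich1.
  by rewrite [_ * T z ^+ _]mulrC -[_ * T y ^+ m]mulrA e mulr1.
rewrite exchange_big /=.
(* The exponents 5m and 3m are not multiples of 4m, so only the term p at z = 1 remains after
   summation. *)
transitivity (\sum_z (- T z ^+ (3 * m + n) - T z ^+ (3 * m) + (z == 1)%:R * P)).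
  apply: eq_bigr => z _; rewrite -mulr_sumr.
  have [->|z0] := eqVneq z 0.
    rewrite teich0 !expr0n addn_eq0 muln_eq0 !eqn0Ngt m_gt0 /=.
    by ring.
  rewrite sum_phi_linear //.
  have [->|z1] := eqVneq z 1; first by rewrite /teich_half teich1 !expr1n; ring.
  by rewrite /teich_half exprD mul0r; ring.
rewrite !big_split /= !sumrN !sum_teichX ?addn_gt0 ?muln_gt0 ?m_gt0 //.
rewrite !ifN ?oppr0 ?add0r; first last.
- apply/negP => /dvdnP[[|[|j]]]; rewrite /n; lia.
- apply/negP => /dvdnP[[|j]]; lia.
rewrite (bigD1 1) //= mul1r big1 ?addr0 // => z /negbTE->.
by rewrite mul0r.
Qed.

Let sum_teich_onem (B : nat) :
  \sum_x T x ^+ (3 * m) * (1 - T x) ^+ B =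
  \sum_(k < B.+1) (-1) ^+ k * 'C(B, k)%:R * (if (4 * m %| 3 * m + k)%N then (4 * m)%:R else 0).
Proof.
under eq_bigr do rewrite exprBn mulr_sumr.
rewrite exchange_big; apply: eq_bigr => k _.
rewrite -sum_teichX ?addn_gt0 ?muln_gt0 ?m_gt0 // mulr_sumr; apply: eq_bigr => x _.
by rewrite expr1n exprD; ring.
Qed.

(* On units u = 1 - T x the map r |-> u^(n + r (p-1)) is affine in r modulo p^2;
   r = n gives the exponent p n of the Teichmuller character. *)
Let phi_onem (x : 'F_p) :
  phi (1 - x) = (1 - n%:R) * (1 - T x) ^+ n + n%:R * (1 - T x) ^+ (n + 4 * m).
Proof.
rewrite /teich_half -/n teich_onem -exprM.
have [->|x1] := eqVneq x 1.
  rewrite teich1 subrr !expr0n addn_eq0 muln_eq0 !eqn0Ngt n_gt0 prime_gt0 //=.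
  by rewrite !mulr0 addr0.
have [w hw] : exists w, (1 - T x) ^+ (4 * m) - 1 = P * w.
  pose z : int := (1 - (nat_of_ord x)%:Z ^+ p) ^+ (4 * m) - 1.
  have [|w hw] := @intr_Fp_eq0 z.
    rewrite rmorphB rmorphXn rmorphB rmorphXn /= -pmulrn natr_Zp (Fp_expp p_prime).
    by rewrite Fp_fermat ?subrr // subr_eq0 eq_sym.
  by exists w; rewrite -hw rmorphB rmorphXn rmorphB rmorphXn.
have hw' : (1 - T x) ^+ (4 * m) = 1 + P * w by rewrite -hw [RHS]addrC subrK.
rewrite exprD hw' {1}p_eq mulSn exprD exprM hw' -[in LHS](prednK n_gt0) exprD_mulP.
by rewrite prednK // !expr1n; ring.
Qed.

(** [phi_onem] leaves the exponents B = 2m and B = 6m. In the first expansion only k = m survives;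
    in the second k = m and k = 5m do, with equal sign and binomial, hence the factor 2. *)
Lemma jacobi_sum3E :
  jacobi_sum 3 =
  (P - 1) * (-1) ^+ m * ((1 - n%:R) * 'C(n, m)%:R + 2 * n%:R * 'C(6 * m, m)%:R).
Proof.
have dvd_m : (4 * m %| 3 * m + m)%N by rewrite -mulSnr.
have S1 : \sum_x T x ^+ (3 * m) * (1 - T x) ^+ n = (-1) ^+ m * 'C(n, m)%:R * (4 * m)%:R.
  have lt_m : (m < n.+1)%N by rewrite /n; lia.
  rewrite sum_teich_onem (bigD1 (Ordinal lt_m)) //= dvd_m big1 ?addr0 // => k.
  rewrite -val_eqE /= => km; rewrite ifN ?mulr0 //.
  by apply: contra km => /(dvdn_4m_cases m_gt0); have := ltn_ord k; rewrite /n; lia.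
have S2 : \sum_x T x ^+ (3 * m) * (1 - T x) ^+ (n + 4 * m) =
    (-1) ^+ m * (2 * 'C(6 * m, m)%:R) * (4 * m)%:R.
  have e6 : (n + 4 * m = 6 * m)%N by rewrite /n; lia.
  have lt_m : (m < (6 * m).+1)%N by lia.
  have lt_5m : (5 * m < (6 * m).+1)%N by lia.
  have dvd_5m : (4 * m %| 3 * m + 5 * m)%N by rewrite -mulnDl (dvdn_mul (d1 := 4)).
  rewrite sum_teich_onem e6 (bigD1 (Ordinal lt_m)) //= dvd_m.
  rewrite (bigD1 (Ordinal lt_5m)) /=; last by rewrite -val_eqE /=; lia.
  rewrite dvd_5m big1 ?addr0 => [|k].
    have -> : 'C(6 * m, 5 * m) = 'C(6 * m, m).
      by rewrite -bin_sub; [congr 'C(_, _) | ]; lia.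
    have -> : (-1) ^+ (5 * m) = (-1) ^+ m :> R.
      by rewrite -signr_odd -[RHS]signr_odd oddM.
    by ring.
  rewrite -!val_eqE /= => /andP[km k5m]; rewrite ifN ?mulr0 //.
  apply/negP => /(dvdn_4m_cases m_gt0) d; have := ltn_ord k; lia.
rewrite /jacobi_sum; under eq_bigr do rewrite phi_onem mulrDr !(mulrCA (_ ^+ _)).
rewrite big_split /= -!mulr_sumr S1 S2 P4 natrM.
by ring.
Qed.

Let two_unit : 2 \is a @GRing.unit R.
Proof.
apply: natr_unit; rewrite prime_coprime //; apply/negP => /dvdn_leq; rewrite p_eq; lia.
Qed.

Lemma teichN1 : T (-1) = -1.
Proof. by rewrite (teichE (-1)) -signr_odd p_eq /= oddM expr1. Qed.

Lemma sqrt_card (x : 'F_p) : #|[pred y | y ^+ 2 == x]|%:R = 1 + phi x.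
Proof.
have [->|x0] := eqVneq x 0.
  rewrite phi0 addr0 (eq_card (B := pred1 0)) ?card1 // => y.
  by rewrite !inE sqrf_eq0.
have [i xi] := prim_rootP g_prim (Fp_fermat x0).
have phix : phi x = (-1) ^+ i.
  by rewrite xi /teich_half -teichX -exprM mulnC exprM prim_half teichX teichN1.
rewrite phix; have [oi|ei] := boolP (odd i); last first.
  pose y := g ^+ i./2.
  have xy : x = y ^+ 2 by rewrite xi /y -exprM muln2 even_halfK.
  have y0 : y != 0 by rewrite expf_neq0 // prim_neq0.
  have yN : y != - y.
    apply/eqP => /(congr1 T) /eqP; rewrite -[- y]mulN1r teichM teichN1 mulN1r -subr_eq0 opprK.
    rewrite -mulr2n -mulr_natl => /eqP /(canRL (mulKr two_unit)); rewrite mulr0 => Ty.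
    by have := teich_unit y0; rewrite Ty unitr0.
  rewrite -signr_odd (negbTE ei) (eq_card (B := pred2 y (- y))) => [|z].
    by rewrite card2 yN.
  by rewrite !inE xy eqf_sqr.
rewrite -signr_odd oi expr1 subrr eq_card0 // => y; rewrite !inE.
apply/negP => /eqP yx.
have y0 : y != 0 by move: x0; rewrite -yx sqrf_eq0.
have := phi_sqr y0; rewrite -phiM -expr2 yx phix -signr_odd oi expr1 => /eqP.
rewrite eq_sym -subr_eq0 opprK => /eqP e2.
by have := two_unit; rewrite (natrD _ 1 1) e2 unitr0.
Qed.

Lemma sum_sqr (h : 'F_p -> R) : \sum_y h (y ^+ 2) = \sum_x h x * (1 + phi x).
Proof.
rewrite (partition_big (fun y : 'F_p => y ^+ 2) xpredT) //=; apply: eq_bigr => x _.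
by rewrite -sqrt_card mulr_natr -sumr_const; apply: eq_bigr => y /eqP->.
Qed.

(** Summing over x = y^2 weights x by 1 + phi(x), and chi phi = chi^3. *)
Lemma jacobi_sum_add :
  \sum_y T y ^+ n * T (1 - y ^+ 2) ^+ n = jacobi_sum 3 + jacobi_sum 1.
Proof.
transitivity (\sum_y (fun x => T x ^+ m * phi (1 - x)) (y ^+ 2)).
  by apply: eq_bigr => y _; rewrite teichX -exprM mul2n.
rewrite (sum_sqr (fun x => T x ^+ m * phi (1 - x))) addrC -big_split; apply: eq_bigr => x _ /=.
by rewrite mul1n mulrDr mulr1 mulrAC /teich_half -exprD (_ : m + n = 3 * m)%N // /n; lia.
Qed.

(** The same substitution twisted by the nonresidue g: phi(g) = -1 turns the sum into a
    difference. *)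
Lemma jacobi_sum_sub :
  T g ^+ m * (\sum_y T y ^+ n * T (1 - g * y ^+ 2) ^+ n) = jacobi_sum 1 - jacobi_sum 3.
Proof.
transitivity (T g ^+ m * \sum_y (fun x => T x ^+ m * phi (1 - g * x)) (y ^+ 2)).
  by congr (_ * _); apply: eq_bigr => y _; rewrite teichX -exprM mul2n.
rewrite (sum_sqr (fun x => T x ^+ m * phi (1 - g * x))) mulr_sumr.
rewrite -sumrB [RHS](reindex_inj (mulfI prim_neq0)); apply: eq_bigr => x _ /=.
have phig : phi g = -1 by rewrite /teich_half -teichX prim_half teichN1.
have e (u : 'F_p) : T u ^+ (3 * m) = T u ^+ m * phi u.
  by rewrite /teich_half -exprD; congr (_ ^+ _); rewrite /n; lia.
rewrite e mul1n phiM phig teichM exprMn; ring.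
Qed.

(** As T(g)^m has square -1, the left side is (J3 + J1)^2 - (J1 - J3)^2 = 4 J3 J1, where Ji is
    [jacobi_sum i]. *)
Lemma jacobsthal_sqr :
  (\sum_y T y ^+ n * T (1 - y ^+ 2) ^+ n) ^+ 2 +
  (\sum_y T y ^+ n * T (1 - g * y ^+ 2) ^+ n) ^+ 2 = 4 * P.
Proof.
have i2 : (T g ^+ m) ^+ 2 = -1.
  by rewrite -exprM muln2 -/n -teichX prim_half teichN1.
set F := \sum_y _ * T (1 - g * _) ^+ n.
have -> : F ^+ 2 = - (T g ^+ m * F) ^+ 2 by rewrite exprMn i2 mulN1r opprK.
by rewrite jacobi_sum_sub jacobi_sum_add -jacobi_sum_norm; ring.
Qed.

End Teichmuller.

(** * Sums of two squares and Jacobsthal sums *)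

(** From (aA + bB)^2 + (aB - bA)^2 = p^2, divisibility forces aB = bA or aA + bB = 0. The latter is
    impossible because aA is odd and bB even. *)
Lemma two_squares_aux (p : nat) (a b A B : int) : prime p ->
  p%:Z = a ^+ 2 + b ^+ 2 -> p%:Z = A ^+ 2 + B ^+ 2 ->
  (a %% 2)%Z = 1 -> (A %% 2)%Z = 1 -> (b %% 2)%Z = 0 ->
  (p %| a * B - b * A)%Z -> a ^+ 2 = A ^+ 2.
Proof.
move=> p_prime pab pAB a1 A1 b0 /dvdzP[k ck].
have p0 : 0 < p%:Z :> int by rewrite ltz_nat prime_gt0.
have sq : (a * A + b * B) ^+ 2 = (1 - k ^+ 2) * p%:Z ^+ 2.
  have -> : (1 - k ^+ 2) * p%:Z ^+ 2 = p%:Z * p%:Z - (k * p%:Z) ^+ 2 by ring.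
  by rewrite -ck {1}pab pAB; ring.
have [k0|k0] := eqVneq k 0.
  have e : a * B = b * A by apply/eqP; rewrite -subr_eq0 ck k0 mul0r.
  apply: (mulfI (lt0r_neq0 p0)).
  transitivity (a ^+ 2 * A ^+ 2 + (a * B) ^+ 2); first by rewrite pAB; ring.
  by rewrite e pab; ring.
have d0 : (a * A + b * B) ^+ 2 = 0.
  apply/eqP; rewrite eq_le sqr_ge0 andbT sq pmulr_lle0 ?exprn_gt0 // subr_le0.
  by rewrite -gtz0_ge1 exprn_even_gt0.
move/eqP: d0; rewrite sqrf_eq0 => /eqP d0.
have := congr1 (fun z => (z %% 2)%Z) d0; rewrite mod0z -modzDm -modzMm a1 A1 -(modzMm b) b0.
by rewrite mul0r.
Qed.

(** The product (aB - bA)(aB + bA) = (a^2 - A^2) p is divisible by p; if p divides the second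
    factor, b is replaced by -b. *)
Lemma two_squares_uniq (p : nat) (a b A B : int) : prime p ->
  p%:Z = a ^+ 2 + b ^+ 2 -> p%:Z = A ^+ 2 + B ^+ 2 ->
  (a %% 2)%Z = 1 -> (A %% 2)%Z = 1 -> (p %% 2 = 1)%N -> A = a \/ A = - a.
Proof.
move=> p_prime pab pAB a1 A1 p1.
have b0 : (b %% 2)%Z = 0.
  have [a' ea] : exists a', a = 2 * a' + 1 by exists (a %/ 2)%Z; lia.
  have [//|b1] : (b %% 2)%Z = 0 \/ (b %% 2)%Z = 1 by lia.
  have [b' eb] : exists b', b = 2 * b' + 1 by exists (b %/ 2)%Z; lia.
  have : p%:Z = 2 * (2 * a' ^+ 2 + 2 * a' + 2 * b' ^+ 2 + 2 * b' + 1).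
    by rewrite pab ea eb; ring.
  move: (2 * a' ^+ 2 + _ + _ + _ + _) => t; lia.
have : (p %| (a * B - b * A) * (a * B + b * A))%Z.
  apply/dvdzP; exists (a ^+ 2 - A ^+ 2).
  transitivity (a ^+ 2 * (A ^+ 2 + B ^+ 2) - (a ^+ 2 + b ^+ 2) * A ^+ 2); first by ring.
  by rewrite -pab -pAB; ring.
have key : a ^+ 2 = A ^+ 2 -> A = a \/ A = - a.
  by move/esym/eqP; rewrite eqf_sqr => /orP[]/eqP->; [left|right].
rewrite dvdzE abszM Euclid_dvdM // => /orP[] d; apply: key.
  exact: (@two_squares_aux p a b A B).
apply: (@two_squares_aux p a (- b) A B) => //; first by rewrite sqrrN.
  by move: b0; clear; lia.
by rewrite mulNr opprK.
Qed.

(** * Integer-valued Legendre symbols and Jacobsthal sums *)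

Section LegendreSymbol.
Variables p m : nat.
Hypothesis p_prime : prime p.
Hypothesis p_eq : p = (4 * m).+1.
Let n := m.*2.

Let m_gt0 : (0 < m)%N. Proof. by move: p_prime; rewrite p_eq; case: m. Qed.
Let n_gt0 : (0 < n)%N. Proof. by rewrite double_gt0. Qed.
Let n2 : (n + n = 4 * m)%N. Proof. by rewrite /n; lia. Qed.
Let fermat := Fp_fermat p_prime p_eq.

(** Euler's criterion, [m.*2] being (p - 1)/2; integer values allow sums to be bounded and reduced
    modulo 8. *)
Definition legendre_symbol (x : 'F_p) : int :=
  if x == 0 then 0 else if x ^+ m.*2 == 1 then 1 else -1.
Local Notation leg := legendre_symbol.

Lemma Fp_half_exp (x : 'F_p) : x != 0 -> x ^+ n = 1 \/ x ^+ n = -1.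
Proof.
move=> x0; have : (x ^+ n) ^+ 2 == 1 by rewrite expr2 -exprD n2 fermat.
by rewrite sqrf_eq1 => /orP[]/eqP->; [left|right].
Qed.

Let two_neq0 : 2 != 0 :> 'F_p.
Proof.
rewrite -(dvdn_pcharf (pchar_Fp p_prime)); apply/negP => /dvdn_leq; rewrite p_eq; lia.
Qed.

Let oneN : -1 == 1 :> 'F_p = false.
Proof. by rewrite eq_sym -subr_eq0 opprK (negbTE two_neq0). Qed.

Lemma legendre_symbol_le1 (x : 'F_p) : `|leg x| <= 1.
Proof. by rewrite /legendre_symbol; case: ifP => // _; case: ifP. Qed.

Lemma legendre_symbolM (x y : 'F_p) : leg (x * y) = leg x * leg y.
Proof.
rewrite /legendre_symbol mulf_eq0.
have [->|x0] := eqVneq x 0; first by rewrite !mul0r.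
have [->|y0] := eqVneq y 0; first by rewrite orbT !mulr0.
rewrite /= exprMn -/n.
by case: (Fp_half_exp x0) => ->; case: (Fp_half_exp y0) => ->;
  rewrite ?mulrNN ?mul1r ?mulr1 ?eqxx ?oneN.
Qed.

Lemma legendre_symbol_int (x : 'F_p) : x != 0 -> leg x = 1 - 2 * (x ^+ n != 1)%:R.
Proof.
by rewrite /legendre_symbol -/n => /negbTE->; case: eqP.
Qed.

Lemma sum_legendre_symbol (A : {set 'F_p}) (f : 'F_p -> 'F_p) :
  {in A, forall y, f y != 0} -> {in [predC A], forall y, f y = 0} ->
  \sum_y leg (f y) = #|A|%:R - 2 * #|[set y in A | f y ^+ n != 1]|%:R.
Proof.
move=> f1 f0; rewrite (bigID (mem A)) /= [X in _ + X]big1 ?addr0 => [|y yA]; last first.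
  by rewrite f0 // /leg /legendre_symbol eqxx.
rewrite (eq_bigr (fun y => 1 - 2 * (f y ^+ n != 1)%:R)) => [|y yA]; last first.
  by rewrite legendre_symbol_int ?f1.
rewrite sumrB sumr_const -mulr_sumr -natr_sum; congr (_ - 2 * _%:R).
rewrite -sum1_card [RHS](eq_bigl (fun y => (y \in A) && (f y ^+ n != 1))).
  by rewrite big_mkcondr; apply: eq_bigr => y _; case: ifP.
by move=> y; rewrite inE.
Qed.

Definition jacobsthal (d : 'F_p) : int := \sum_y leg y * leg (1 - d * y ^+ 2).

Lemma jacobsthal_le (d : 'F_p) : `|jacobsthal d| <= p%:R.
Proof.
apply: le_trans (ler_norm_sum _ _ _) _.
rewrite -[X in _ <= X%:R](card_Fp p_prime) -[#|_|]sum1_card natr_sum.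
apply: ler_sum => y _; rewrite normrM -[1%:R]mulr1.
by apply: ler_pM => //; apply: legendre_symbol_le1.
Qed.

Let A := [set y : 'F_p | (y != 0) && (y ^+ 2 != 1)].
Let N := [set y in A | (y * (1 - y ^+ 2)) ^+ n != 1].

(** If y^2 = -1, then y (1 - y^2) = 2y = (1 + y)^2 is a square, so such y lie outside [N]. *)
Let NP (y : 'F_p) : y \in N -> [/\ y != 0, y ^+ 2 != 1, y ^+ 2 != -1 & (y * (1 - y ^+ 2)) ^+ n != 1].
Proof.
rewrite !inE => /andP[/andP[y0 y1] yN]; split => //.
apply: contra yN => /eqP y2; apply/eqP.
have y10 : 1 + y != 0.
  by apply: contra y1; rewrite addrC addr_eq0 => /eqP ->; rewrite sqrrN expr1n.
have -> : y * (1 - y ^+ 2) = (1 + y) ^+ 2 by rewrite sqrrD y2; ring.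
by rewrite -exprM mul2n -addnn n2 fermat.
Qed.

Let expn_even (x : 'F_p) : (- x) ^+ n = x ^+ n.
Proof. by rewrite exprNn -signr_odd odd_double mul1r. Qed.

Let N_opp (y : 'F_p) : y \in N -> - y \in N.
Proof.
by case/NP=> y0 y1 _ yN; rewrite !inE oppr_eq0 sqrrN y0 y1 mulNr expn_even.
Qed.

Let N_inv (y : 'F_p) : y \in N -> y^-1 \in N.
Proof.
case/NP=> y0 y1 _ yN; rewrite !inE invr_eq0 exprVn invr_eq1 y0 y1 /=.
have -> : y^-1 * (1 - (y ^+ 2)^-1) = - (y * (1 - y ^+ 2) * (y^-1) ^+ 4) by field.
rewrite expn_even exprMn -(exprM _ 4) (_ : 4 * n = 4 * m * 2)%N; last by rewrite /n; lia.
by rewrite (exprM _ (4 * m)) fermat ?invr_eq0 // expr1n mulr1.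
Qed.

(* y and z have the same image under y |-> y^2 + y^-2 iff z is one of +-y, +-1/y;
   the orbits of this action on N have exactly four elements since the only fixed
   points are the square roots of 1 and -1. *)
Lemma card_nonres_orbits : (4 %| #|N|)%N.
Proof.
pose h (y : 'F_p) := y ^+ 2 + y ^- 2.
apply/dvdnP; exists #|preim_partition h N|.
apply: (card_uniform_partition _ (preim_partitionP h N)) => B /imsetP[y yN ->{B}].
have [y0 y1 yN1 _] := NP yN.
pose s := [:: y; - y; y^-1; - y^-1].
have yoppy (z : 'F_p) : z != 0 -> (z == - z) = false.
  by move=> z0; rewrite -subr_eq0 opprK -mulr2n -mulr_natr mulf_eq0 (negbTE z0) (negbTE two_neq0).
have yinv (c : 'F_p) : (y == c * y^-1) = (y ^+ 2 == c).
  by rewrite -(inj_eq (mulIf y0)) mulfVK // expr2.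
have s_uniq : uniq s.
  have e1 : (y == y^-1) = false by have := yinv 1; rewrite mul1r (negbTE y1).
  have e2 : (y == - y^-1) = false by have := yinv (-1); rewrite mulN1r (negbTE yN1).
  rewrite /= !inE !negb_or yoppy // e1 e2 eqr_oppLR e2 eqr_opp e1 yoppy ?invr_eq0 //.
rewrite -(card_uniqP s_uniq : #|s| = 4%N); apply: eq_card => z.
rewrite in_set; apply/andP/idP => [[zN /eqP hyz]|].
  have [z0 _ _ _] : [/\ z != 0, z ^+ 2 != 1, z ^+ 2 != -1 & true] by case: (NP zN).
  have : (z ^+ 2 - y ^+ 2) * ((z * y) ^+ 2 - 1) = 0.
    transitivity ((h z - h y) * (z * y) ^+ 2); last by rewrite hyz subrr mul0r.
    by rewrite /h; field; rewrite y0 z0.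
  move/eqP; rewrite !inE mulf_eq0 !subr_eq0 eqf_sqr sqrf_eq1.
  have zinv (c : 'F_p) : (z == c * y^-1) = (z * y == c).
    by rewrite -(inj_eq (mulIf y0)) mulfVK.
  have := zinv 1; have := zinv (-1); rewrite mul1r mulN1r => -> ->.
  by rewrite !orbA.
move=> z_s; have zs : [|| z == y, z == - y, z == y^-1 | z == - y^-1] by move: z_s; rewrite !inE.
have zN : z \in N.
  by case/or4P: zs => /eqP->; rewrite ?N_opp ?N_inv ?N_opp ?N_inv.
have h_opp (x : 'F_p) : h (- x) = h x by rewrite /h sqrrN.
have h_inv (x : 'F_p) : h x^-1 = h x by rewrite /h exprVn invrK addrC.
by split=> //; case/or4P: zs => /eqP->; rewrite ?h_opp ?h_inv.
Qed.

(** The sum is #|A| - 2 #|N|, where [A] omits 0, 1 and -1 and 4 divides #|N|. *)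
Lemma jacobsthal1_mod8 : exists c : int, jacobsthal 1 = (4 * m)%:Z - 2 - 8 * c.
Proof.
rewrite /jacobsthal; under eq_bigr do rewrite mul1r -legendre_symbolM.
have cA : (#|A| + 3 = (4 * m).+1)%N.
  rewrite -p_eq -[in RHS](card_Fp p_prime) -(cardsC A); congr (_ + _)%N.
  pose s := [:: 0; 1; -1 : 'F_p].
  have s_uniq : uniq s by rewrite /= !inE eq_sym oner_eq0 eq_sym oppr_eq0 oner_eq0 eq_sym oneN.
  rewrite -(card_uniqP s_uniq : #|s| = 3%N); apply: eq_card => z.
  by rewrite !inE negb_and !negbK sqrf_eq1.
rewrite (@sum_legendre_symbol A) => [|y|y]; first last.
- rewrite !inE negb_and !negbK => /orP[/eqP->|/eqP->]; first by rewrite mul0r.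
  by rewrite subrr mulr0.
- by rewrite inE => /andP[y0 y1]; rewrite mulf_neq0 // subr_eq0 eq_sym.
rewrite -/N; have /dvdnP[c ->] := card_nonres_orbits.
exists c%:Z; rewrite natrM.
have -> : #|A|%:R = (4 * m)%:Z - 2 by lia.
by ring.
Qed.

Variable g : 'F_p.
Hypothesis g_prim : (4 * m).-primitive_root g.

(** As g is a nonresidue, 1 - g y^2 never vanishes, so the sum consists of 4m signs. *)
Lemma jacobsthal_nonres_even : exists B : int, jacobsthal g = 2 * B.
Proof.
rewrite /jacobsthal; under eq_bigr do rewrite -legendre_symbolM.
rewrite (@sum_legendre_symbol [set y | y != 0]) => [|y|y].
- have -> : #|[set y : 'F_p | y != 0]| = (4 * m)%N.
    by rewrite cardsE cardC1 card_Fp // p_eq.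
  set M := #|_|; exists ((2 * m)%:R - M%:R).
  by rewrite !natrM; ring.
- rewrite inE => y0; rewrite mulf_neq0 // subr_eq0 eq_sym; apply/eqP => gy.
  have g_sqr : g = y^-1 ^+ 2 by rewrite exprVn -[LHS](mulfK (expf_neq0 2 y0)) gy mul1r.
  have := prim_half p_prime p_eq g_prim; rewrite g_sqr -exprM mul2n -/n -addnn n2.
  by rewrite fermat ?invr_eq0 // => /eqP; rewrite eq_sym oneN.
- by rewrite !inE negbK => /eqP->; rewrite mul0r.
Qed.

End LegendreSymbol.

(** * Reduction of rationals modulo p^2 *)

Lemma unitr_Zp_sqr (p k : nat) : prime p -> coprime p k ->
  k%:R \is a @GRing.unit 'Z_(p ^ 2).
Proof.
move=> p_prime pk; rewrite unitZpE ?coprimeXl //.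
by rewrite -(exp1n 2) ltn_exp2r // prime_gt1.
Qed.

Lemma intr_Zp_sqr_eq0 (p : nat) (z : int) : prime p ->
  z%:~R = 0 :> 'Z_(p ^ 2) -> ((p ^ 2)%N %| z)%Z.
Proof.
move=> p_prime z0.
have p2_gt1 : (1 < p ^ 2)%N by rewrite -(exp1n 2) ltn_exp2r // prime_gt1.
have nat0 (k : nat) : k%:R = 0 :> 'Z_(p ^ 2) -> (p ^ 2 %| k)%N.
  by move/(congr1 val); rewrite /= val_Zp_nat // => /eqP.
rewrite dvdzE /=; apply: nat0; case: z z0 => k //=.
by rewrite NegzE /= rmorphN /= => /eqP; rewrite oppr_eq0 => /eqP.
Qed.

Section Reduction.
Variables (R : comUnitRingType) (p : nat).
Hypothesis p_prime : prime p.
Hypothesis natr_unit : forall k : nat, coprime p k -> k%:R \is a @GRing.unit R.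

(* r is the image of the p-integral rational x, for R standing for Z / p^2. *)
Definition reduces_to (x : rat) (r : R) : Prop :=
  exists u v : int, [/\ coprimez p v, x * v%:~R = u%:~R & r * v%:~R = u%:~R].

Lemma reduces_to_int (z : int) : reduces_to z%:~R z%:~R.
Proof. by exists z, 1; split; rewrite ?rmorph1 ?mulr1 // coprimezE coprimen1. Qed.

Lemma reduces_to_nat (k : nat) : reduces_to k%:R k%:R.
Proof. exact: (reduces_to_int k). Qed.

Lemma reduces_toD (x y : rat) (r s : R) :
  reduces_to x r -> reduces_to y s -> reduces_to (x + y) (r + s).
Proof.
move=> [u [v [cv xv rv]]] [u' [v' [cv' xv' rv']]].
exists (u * v' + u' * v), (v * v'); split; first by rewrite coprimezMr cv cv'.
  by rewrite rmorphD !rmorphM /= -xv -xv'; ring.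
by rewrite rmorphD !rmorphM /= -rv -rv'; ring.
Qed.

Lemma reduces_toM (x y : rat) (r s : R) :
  reduces_to x r -> reduces_to y s -> reduces_to (x * y) (r * s).
Proof.
move=> [u [v [cv xv rv]]] [u' [v' [cv' xv' rv']]].
exists (u * u'), (v * v'); split; first by rewrite coprimezMr cv cv'.
  by rewrite !rmorphM /= -xv -xv'; ring.
by rewrite !rmorphM /= -rv -rv'; ring.
Qed.

Lemma reduces_toN (x : rat) (r : R) : reduces_to x r -> reduces_to (- x) (- r).
Proof.
by move=> xr; rewrite -mulN1r -[- r]mulN1r; apply: reduces_toM => //; apply: (reduces_to_int (-1)).
Qed.

Lemma reduces_toX (x : rat) (r : R) (k : nat) : reduces_to x r -> reduces_to (x ^+ k) (r ^+ k).
Proof.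
move=> xr; elim: k => [|k IHk]; first exact: (reduces_to_int 1).
by rewrite !exprS; apply: reduces_toM.
Qed.

Lemma reduces_to_sum (k : nat) (F : nat -> rat) (G : nat -> R) :
  (forall i, (i < k)%N -> reduces_to (F i) (G i)) ->
  reduces_to (\sum_(i < k) F i) (\sum_(i < k) G i).
Proof.
elim: k => [|k IHk] FG; first by rewrite !big_ord0; apply: (reduces_to_int 0).
rewrite !big_ord_recr /=; apply: reduces_toD; last exact: FG.
by apply: IHk => i ik; apply: FG; apply: ltnW.
Qed.

Lemma intr_unit_coprime (z : int) : coprimez p z -> z%:~R \is a @GRing.unit R.
Proof.
case: z => k cz; first exact: natr_unit.
by rewrite NegzE rmorphN unitrN; apply: natr_unit; move: cz; rewrite coprimezE.
Qed.

Lemma reduces_toV (z : int) : coprimez p z -> reduces_to z%:~R^-1 z%:~R^-1.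
Proof.
move=> cz; exists 1, z; split=> //; last by rewrite mulVr ?intr_unit_coprime.
rewrite mulVf // intr_eq0; apply: contraTneq cz => ->.
by rewrite coprimezE /= /coprime gcdn0 neq_ltn prime_gt1 ?orbT.
Qed.

Hypothesis intr_eq0_dvd : forall z : int, z%:~R = 0 :> R -> ((p ^ 2)%N %| z)%Z.

(** For x = u/v and y = u'/v', the numerator u v' - u' v vanishes in R, hence is a multiple of p^2,
    and the denominator of (x - y)/p^2 divides v v'. *)
Lemma reduces_to_congr (x y : rat) (r : R) :
  reduces_to x r -> reduces_to y r -> rat_congr p (p ^ 2) x y.
Proof.
move=> [u [v [cv xv rv]]] [u' [v' [cv' xv' rv']]].
have /intr_eq0_dvd/dvdzP[w hw] : (u * v' - u' * v)%:~R = 0 :> R.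
  by rewrite rmorphB !rmorphM /= -rv -rv'; ring.
have p0 : p%:R != 0 :> rat by rewrite pnatr_eq0 -lt0n prime_gt0.
rewrite /rat_congr /p_integral; set q := _ / _.
have hq : q * (v * v')%:~R = w%:~R.
  rewrite /q natrX; apply: (mulIf (expf_neq0 2 p0)).
  have -> : w%:~R * p%:R ^+ 2 = (w * (p ^ 2)%N)%:~R :> rat by rewrite rmorphM /= -pmulrn natrX.
  rewrite -hw rmorphB !rmorphM /= -xv -xv'; field; exact: p0.
have d_dvd : (denq q %| v * v')%Z.
  have : numq q * (v * v') = w * denq q.
    apply: (@intr_inj rat); rewrite !rmorphM /= -hq numqE rmorphM /=.
    by ring.
  move=> e; have : (denq q %| numq q * (v * v'))%Z by rewrite e dvdz_mull.
  by rewrite Gauss_dvdzr // coprimezE coprime_sym coprime_num_den.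
have : coprimez p (v * v') by rewrite coprimezMr cv cv'.
by rewrite coprimezE; apply: coprime_dvdr.
Qed.

End Reduction.

(** * The unit root *)

(** A is 1 modulo 4 for odd m and -1 for even m, which decides between a and -a. *)
Lemma sign_mod4 (m : nat) (a A c : int) : A = 2 * m%:Z - 1 - 4 * c ->
  (a %% 4)%Z = 1 -> A = a \/ A = - a -> A = - (-1) ^+ m * a.
Proof.
move=> A_eq a_mod4 Aa; rewrite -signr_odd.
by case: (boolP (odd m)) => om /=; rewrite ?expr1 ?expr0; lia.
Qed.

(** The bounds and 4q < q^2 force k to be 0 or 1; k = 1 would make q^2, which is 1 modulo 4, a
    multiple of 4. *)
Lemma two_squares_of_mod_sqr (m : nat) (k q A B : int) : (0 < m)%N -> q = 4 * m%:Z + 1 ->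
  (2 * A) ^+ 2 <= q ^+ 2 -> (2 * B) ^+ 2 <= q ^+ 2 ->
  (2 * A) ^+ 2 + (2 * B) ^+ 2 - 4 * q = k * q ^+ 2 -> q = A ^+ 2 + B ^+ 2.
Proof.
move=> m0 q_eq A2 B2 e.
have q4 : 4 < q by lia.
have qq : 4 * q < q ^+ 2 by rewrite expr2 ltr_pM2r //; lia.
have q2 : 0 < q ^+ 2 by rewrite exprn_gt0 //; lia.
have k_lt2 : k < 2 by rewrite -(ltr_pM2r q2); lia.
have k_gtN : -1 < k.
  by rewrite -(ltr_pM2r q2); have := sqr_ge0 (2 * A); have := sqr_ge0 (2 * B); lia.
have [k0|k1] : k = 0 \/ k = 1 by clear -k_lt2 k_gtN; lia.
  apply: (mulfI (x := 4)) => //; apply/eqP; rewrite eq_sym -subr_eq0; apply/eqP.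
  by transitivity ((2 * A) ^+ 2 + (2 * B) ^+ 2 - 4 * q); [ring | rewrite e k0 mul0r].
have : 4 * (A ^+ 2 + B ^+ 2 - q - 4 * m%:Z ^+ 2 - 2 * m%:Z) = 1.
  transitivity ((2 * A) ^+ 2 + (2 * B) ^+ 2 - 4 * q - (4 * m%:Z + 1) ^+ 2 + 1); first by ring.
  by rewrite e k1 q_eq; ring.
by clear; move: (_ - 2 * m%:Z) => t; lia.
Qed.

Section UnitRoot.
Variables (R : comUnitRingType) (p m : nat) (a b : int).
Hypothesis p_prime : prime p.
Hypothesis p_sqr0 : p%:R ^+ 2 = 0 :> R.
Hypothesis natr_unit : forall k : nat, coprime p k -> k%:R \is a @GRing.unit R.
Hypothesis intr_eq0_dvd : forall z : int, z%:~R = 0 :> R -> ((p ^ 2)%N %| z)%Z.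
Hypothesis p_eq : p = (4 * m).+1.
Hypothesis p_ab : p%:Z = a ^+ 2 + b ^+ 2.
Hypothesis a_mod4 : (a %% 4)%Z = 1.

Let m_gt0 : (0 < m)%N. Proof. by move: p_prime; rewrite p_eq; case: m. Qed.

Lemma intr_legendre_symbol (x : 'F_p) :
  (legendre_symbol m x)%:~R = teich R x ^+ m.*2.
Proof.
rewrite /legendre_symbol.
have [->|x0] := eqVneq x 0.
  by rewrite (teich0 p_prime p_sqr0) expr0n double_eq0 eqn0Ngt m_gt0.
rewrite -(teichX p_prime p_sqr0).
case: (Fp_half_exp p_prime p_eq x0) => ->; first by rewrite eqxx (teich1 p_prime p_sqr0).
rewrite ifN ?(teichN1 p_prime p_sqr0 p_eq) ?rmorphN //.
apply/eqP => /(congr1 (@teich R p)).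
rewrite (teichN1 p_prime p_sqr0 p_eq) (teich1 p_prime p_sqr0) => /eqP.
rewrite eq_sym -subr_eq0 opprK => /eqP e2.
have : 2 \is a @GRing.unit R.
  by apply: natr_unit; rewrite prime_coprime //; apply/negP => /dvdn_leq; rewrite p_eq; lia.
by rewrite (natrD _ 1 1) e2 unitr0.
Qed.

Lemma intr_jacobsthal (d : 'F_p) :
  (jacobsthal m d)%:~R =
  \sum_(y : 'F_p) teich R y ^+ m.*2 * teich R (1 - d * y ^+ 2) ^+ m.*2.
Proof.
by rewrite rmorph_sum; apply: eq_bigr => y _; rewrite rmorphM /= !intr_legendre_symbol.
Qed.

(** [jacobsthal_sqr] is read as an integer congruence modulo p^2, which the trivial bounds upgrade
    to p = A^2 + B^2. Uniqueness gives A = a or A = -a, and [jacobsthal1_mod8] fixes the sign. *)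
Lemma jacobsthal1E : jacobsthal m (1 : 'F_p) = - (-1) ^+ m * (2 * a).
Proof.
have [g g_prim] := Fp_prim_root p_prime p_eq.
have [c Ec] := jacobsthal1_mod8 p_prime p_eq.
have [B EB] := jacobsthal_nonres_even p_prime p_eq g_prim.
have leE := jacobsthal_le m p_prime 1; have leF := jacobsthal_le m p_prime g.
have := jacobsthal_sqr p_prime p_sqr0 natr_unit p_eq g_prim.
have -> : \sum_(y : 'F_p) teich R y ^+ m.*2 * teich R (1 - y ^+ 2) ^+ m.*2 = (jacobsthal m (1 : 'F_p))%:~R.
  by rewrite intr_jacobsthal; apply: eq_bigr => y _; rewrite mul1r.
rewrite -intr_jacobsthal => E0.
have /intr_eq0_dvd/dvdzP[k hk] :
    (jacobsthal m (1 : 'F_p) ^+ 2 + jacobsthal m g ^+ 2 - 4 * p%:Z)%:~R = 0 :> R.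
  by rewrite rmorphB rmorphD !rmorphXn rmorphM /= E0 subrr.
pose A : int := 2 * m%:Z - 1 - 4 * c.
have EA : jacobsthal m (1 : 'F_p) = 2 * A by rewrite Ec /A; clear; lia.
move: hk leE leF; rewrite EA EB !natz => hk leE leF.
have AB : p%:Z = A ^+ 2 + B ^+ 2.
  have A2 : (2 * A) ^+ 2 <= p%:Z ^+ 2 by rewrite -(real_normK (num_real (2 * A))) lerXn2r ?nnegrE.
  have B2 : (2 * B) ^+ 2 <= p%:Z ^+ 2 by rewrite -(real_normK (num_real (2 * B))) lerXn2r ?nnegrE.
  by apply: (@two_squares_of_mod_sqr m k) => //; rewrite p_eq; clear; lia.
have a1 : (a %% 2)%Z = 1 by move: a_mod4; clear; lia.
have A1 : (A %% 2)%Z = 1 by rewrite /A; clear; lia.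
have p1 : (p %% 2 = 1)%N by rewrite p_eq; clear; lia.
have Aa := two_squares_uniq p_prime p_ab AB a1 A1 p1.
by rewrite (sign_mod4 (A := A) (m := m) (c := c) erefl a_mod4 Aa); ring.
Qed.

Lemma coprime_double : coprimez p (2 * a).
Proof.
rewrite coprimezMr coprimezE /= prime_coprime //; apply/andP; split.
  by apply/negP => /dvdn_leq; rewrite p_eq; lia.
rewrite coprimezE /= prime_coprime //; apply/negP => /dvdn_leq d.
have a0 : (0 < `|a|)%N by rewrite absz_gt0; apply/eqP => a0; move: a_mod4; rewrite a0.
have pa := d a0.
have : p%:Z ^+ 2 <= a ^+ 2 by rewrite -(real_normK (num_real a)) lerXn2r ?nnegrE // -abszE lez_nat.
have : a ^+ 2 <= p%:Z by rewrite p_ab lerDl sqr_ge0.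
have : 1 < p%:Z by rewrite ltz_nat prime_gt1.
by clear; move: (p%:Z) (a ^+ 2) => x y; nia.
Qed.

(* D = -J(chi^-1, phi) is the unit root of X^2 - 2 (-1)^m a X + p. *)
Lemma sum_bin_mul_unit_root :
  \sum_(k < m.*2.+1) ('C(m.*2, k) * 'C(m.*2 + k, k))%:R =
  (-1) ^+ m * ((2 * a)%:~R - p%:R * (2 * a)%:~R^-1) :> R.
Proof.
have [g g_prim] := Fp_prim_root p_prime p_eq.
have D_unit := sum_bin_mul_unit p_prime p_sqr0 natr_unit p_eq.
have DJ := sum_bin_mulE p_prime p_sqr0 natr_unit p_eq.
rewrite -(jacobi_sum3E p_prime p_sqr0 p_eq g_prim) in DJ.
have J_add := jacobi_sum_add p_prime p_sqr0 natr_unit p_eq g_prim.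
have J_norm := jacobi_sum_norm p_prime p_sqr0 p_eq g_prim.
have E : \sum_(y : 'F_p) teich R y ^+ m.*2 * teich R (1 - y ^+ 2) ^+ m.*2 = - (-1) ^+ m * (2 * a)%:~R.
  transitivity ((jacobsthal m (1 : 'F_p))%:~R : R).
    by rewrite intr_jacobsthal; apply: eq_bigr => y _; rewrite mul1r.
  by rewrite jacobsthal1E rmorphM rmorphN rmorphXn rmorphN1.
move: D_unit DJ J_add J_norm; rewrite E; set D := \sum_(k < _) _.
move: (jacobi_sum _ _ _ 3) (jacobi_sum _ _ _ 1) => J J' D_unit DJ J_add J_norm.
have s2 : (-1) ^+ m * (-1) ^+ m = 1 :> R by rewrite -exprMn mulrNN mulr1 expr1n.
have a_unit := intr_unit_coprime natr_unit coprime_double.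
move: ((-1) ^+ m) ((2 * a)%:~R) s2 a_unit J_add => s x s2 x_unit J_add.
have J'E : J' = - s * x - J by rewrite J_add; ring.
have D2 : D * (D - s * x) = - p%:R by rewrite -J_norm J'E DJ; ring.
(* Since D is a unit, D - s x is a multiple of p; hence p D may be replaced by p s x in the
   correction term below. *)
have pD : p%:R * (D - s * x) = 0 :> R.
  by apply: (mulrI D_unit); rewrite mulrCA D2 mulr0 mulrN -expr2 p_sqr0 oppr0.
apply/eqP; rewrite -subr_eq0; apply/eqP; apply: (mulrI D_unit).
apply: (mulIr x_unit); rewrite mulr0 mul0r.
have xx := mulVr x_unit; move: (x^-1) xx => x' xx.
transitivity (D * (D - s * x) * x + s * (p%:R * D) * (x' * x)); first by ring.
have pD' : p%:R * D = p%:R * s * x by apply/eqP; rewrite -subr_eq0 -mulrA -mulrBr pD.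
by rewrite D2 xx pD'; ring: s2.
Qed.

End UnitRoot.

Theorem theorem2p9 (p : nat) (a b : int) :
  prime p -> (p %% 4 = 1)%N ->
  (p%:Z = a ^+ 2 + b ^+ 2) -> (a %% 4)%Z = 1 ->
  let n := (p.-1)./2 in
  let S8 := \sum_(0 <= k < n.+1) (('C(2 * k, k) ^ 2)%N%:R / (8%:R ^+ k) : rat) in
  let S16 := \sum_(0 <= k < n.+1) (('C(2 * k, k) ^ 2)%N%:R / ((- 16%:R) ^+ k) : rat) in
  let A : rat := (-1) ^+ (p.-1 %/ 4) * (2%:R * a%:~R - p%:R / (2%:R * a%:~R)) in
  [/\ rat_congr p (p ^ 2) S8 S16,
      rat_congr p (p ^ 2) S16 (legendreP n 3%:R)
    & rat_congr p (p ^ 2) (legendreP n 3%:R) A].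
Proof.
move=> p_prime p_mod4 p_ab a_mod4 n S8 S16 A.
pose R : comUnitRingType := 'Z_(p ^ 2).
have natr_unit (k : nat) : coprime p k -> k%:R \is a @GRing.unit R by exact: unitr_Zp_sqr.
have eq0_dvd (z : int) : z%:~R = 0 :> R -> ((p ^ 2)%N %| z)%Z by exact: intr_Zp_sqr_eq0.
have p_sqr0 : p%:R ^+ 2 = 0 :> R.
  by rewrite -natrX pchar_Zp // -(exp1n 2) ltn_exp2r // prime_gt1.
pose m := (p.-1 %/ 4)%N.
have p_eq : p = (4 * m).+1 by rewrite /m; have := prime_gt0 p_prime; lia.
have n_eq : n = m.*2 by rewrite /n p_eq /=; lia.
pose u (k : nat) : nat := ('C(n, k) * 'C(n + k, k))%N.
pose D : R := \sum_(k < n.+1) (u k)%:R.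
have LE : legendreP n 3%:R = \sum_(k < n.+1) (u k)%:R.
  by rewrite legendrePE; apply: eq_bigr => k _; rewrite (_ : (3%:R - 1) / 2 = 1) ?expr1n ?mulr1.
(* Evenness of n gives P_n(3) = P_n(-3), and (x - 1)/2 is -2 at x = -3. *)
have LE' : legendreP n 3%:R = \sum_(k < n.+1) (u k)%:R * (-2) ^+ k.
  have := legendrePN n 3%:R; rewrite -signr_odd n_eq odd_double mul1r -n_eq => <-.
  by rewrite legendrePE; apply: eq_bigr => k _; rewrite (_ : (-3%:R - 1) / 2 = -2).
(* The rational identity is pulled back to the integers, from where it can be mapped to R. *)
have ZE : \sum_(k < n.+1) (u k)%:Z * (-2) ^+ k = \sum_(k < n.+1) (u k)%:Z.
  apply: (@intr_inj rat); rewrite !rmorph_sum /= -[RHS]LE LE'; apply: eq_bigr => k _.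
  by rewrite rmorphM rmorphXn rmorphN.
have DE : D = \sum_(k < n.+1) (u k)%:R * (-2) ^+ k.
  have := congr1 (intr : int -> R) ZE; rewrite !rmorph_sum /= => hZ.
  transitivity (\sum_(k < n.+1) (u k)%:Z%:~R : R) => //; rewrite -hZ; apply: eq_bigr => k _.
  by rewrite rmorphM rmorphXn rmorphN.
have redL : reduces_to p (legendreP n 3%:R) D.
  by rewrite LE; apply: (reduces_to_sum (F := fun k => (u k)%:R)
    (G := fun k => (u k)%:R)) => k _; apply: reduces_to_nat.
have two_cop : coprime p 2.
  by rewrite prime_coprime //; apply/negP => /dvdn_leq; rewrite p_eq; have := prime_gt1 p_prime; lia.
have cop (c : nat) (j : nat) : c = (2 ^ j)%N -> coprime p c by move=> ->; rewrite coprimeXr.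
have central (k : nat) : (k < n.+1)%N -> (-16) ^+ k * (u k)%:R = ('C(2 * k, k) ^ 2)%N%:R :> R.
  rewrite ltnS /u n_eq natrX => kn.
  exact: (bin_mul_central_sqr p_prime p_sqr0 natr_unit p_eq).
have red16 : reduces_to p S16 D.
  rewrite /S16 big_mkord; apply: (reduces_to_sum (F := fun k => ('C(2 * k, k) ^ 2)%N%:R / (- 16%:R) ^+ k)
    (G := fun k => (u k)%:R)) => k kn.
  have c16 : coprimez p (-16) by rewrite coprimezE /=; apply: (cop _ 4).
  have e : (u k)%:R = ('C(2 * k, k) ^ 2)%N%:R * ((-16)%:~R^-1) ^+ k :> R.
    rewrite -central // exprVn mulrC mulrA mulVr ?mul1r // unitrX //.
    by apply: (intr_unit_coprime natr_unit c16).
  rewrite e -exprVn; apply: reduces_toM; first exact: reduces_to_nat.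
  by apply: reduces_toX; apply: (reduces_toV p_prime natr_unit c16).
(* Modulo p^2 the k-th term is (-16)^k u_k / 8^k = (-2)^k u_k, so the second form of D is the one to
   compare with. *)
have red8 : reduces_to p S8 D.
  rewrite /S8 big_mkord DE; apply: (reduces_to_sum (F := fun k => ('C(2 * k, k) ^ 2)%N%:R / 8%:R ^+ k)
    (G := fun k => (u k)%:R * (-2) ^+ k)) => k kn.
  have c8 : coprimez p 8 by rewrite coprimezE /=; apply: (cop _ 3).
  have u8 := intr_unit_coprime natr_unit c8.
  have e : (u k)%:R * (-2) ^+ k = ('C(2 * k, k) ^ 2)%N%:R * (8%:~R^-1) ^+ k :> R.
    apply: (mulIr (unitrX k u8)); rewrite -[RHS]mulrA exprVn mulVr ?unitrX // mulr1.
    rewrite -central // -mulrA -exprMn [RHS]mulrC; congr (_ * _ ^+ _).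
    by rewrite mulNr -natrM.
  rewrite e -exprVn; apply: reduces_toM; first exact: reduces_to_nat.
  by apply: reduces_toX; apply: (reduces_toV p_prime natr_unit c8).
have redA : reduces_to p A D.
  have c2a := coprime_double p_prime p_eq p_ab a_mod4.
  rewrite /D /u n_eq (sum_bin_mul_unit_root p_prime p_sqr0 natr_unit eq0_dvd p_eq p_ab a_mod4).
  rewrite /A -/m (_ : 2%:R * a%:~R = (2 * a)%:~R); last by rewrite rmorphM.
  apply: reduces_toM; first by apply: reduces_toX; apply: (reduces_to_int _ _ (-1)).
  apply: reduces_toD; first exact: reduces_to_int.
  apply: reduces_toN; apply: reduces_toM; first exact: reduces_to_nat.
  exact: (reduces_toV p_prime natr_unit c2a).
split; apply: (reduces_to_congr p_prime eq0_dvd); eassumption.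
Qed.
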